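(* Let $N\in\mathbb{N}$, $a\ge0$, $b>0$, and put $\alpha:=a+b-1$, $\beta:=b-1$. For $\kappa>0$ let $X_\kappa$ be an $\mathbb{R}^N$-valued random variable whose distribution is the probability measure on $A:=\{x\in\mathbb{R}^N:\ -1\le x_1\le\dots\le x_N\le 1\}$ with Lebesgue density $$c_\kappa\prod_{1\le i<j\le N}(x_j-x_i)^{\kappa}\prod_{i=1}^N(1-x_i)^{\frac{\kappa(a+b)}{2}-\frac12}(1+x_i)^{\frac{\kappa b}{2}-\frac12},$$ with normalizing constant $c_\kappa>0$. Let $z=(z_1,\dots,z_N)$ be the vector of ordered zeros $z_1\le\dots\le z_N$ of the Jacobi polynomial $P_N^{(\alpha,\beta)}$. Then $\sqrt{\kappa}(X_\kappa-z)$ converges in distribution, as $\kappa\to\infty$, to the centered $N$-dimensional normal distribution $N(0,\Sigma)$, where $\Sigma$ is invertible and $S=\Sigma^{-1}=(s_{i,j})_{i,j=1,\dots,N}$ is given by $$s_{j,j}=\sum_{l=1,\,l\ne j}^N\frac{1}{(z_j-z_l)^2}+\frac{a+b}{2}\frac{1}{(1-z_j)^2}+\frac{b}{2}\frac{1}{(1+z_j)^2},\qquad s_{i,j}=\frac{-1}{(z_i-z_j)^2}\ (i\ne j).$$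
   Context: For $\alpha,\beta>-1$, $P_N^{(\alpha,\beta)}$ denotes the classical Jacobi polynomial of degree $N$, orthogonal on $]-1,1[$ with respect to the weight $(1-x)^\alpha(1+x)^\beta$; its $N$ zeros are simple and lie in $]-1,1[$. *)

(* Defs.v *)
From HB Require Import structures.
From mathcomp Require Import all_boot all_order all_algebra.
From mathcomp Require Import all_classical all_reals all_analysis.
Set Implicit Arguments. Unset Strict Implicit. Unset Printing Implicit Defensive.
Import Order.TTheory GRing.Theory Num.Theory.
Import numFieldNormedType.Exports.
Local Open Scope ring_scope.

Section Defs.
Variable R : realType.

Definition gbin (r : R) (m : nat) : R :=
  (\prod_(i < m) (r - i%:R)) / (m`!)%:R.

(* Jacobi polynomial P_N^{(al,be)} (Szego (4.3.2)):
   sum_{k=0}^N binom(N+al, N-k) binom(N+be, k) ((x-1)/2)^k ((x+1)/2)^(N-k) *)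
Definition jacobi (N : nat) (al be : R) : {poly R} :=
  \sum_(k < N.+1)
     (gbin (N%:R + al) (N - k) * gbin (N%:R + be) k) *:
       (((2^-1) *: ('X - 1)) ^+ k * ((2^-1) *: ('X + 1)) ^+ (N - k)).

(* iterated Lebesgue integral over R^n of a function of the coordinate
   list [x_0; ...; x_{n-1}]  (= integral w.r.t. n-dim Lebesgue measure
   for integrable / nonnegative measurable functions, by Fubini-Tonelli) *)
Fixpoint iter_int (n : nat) (f : seq R -> R) : \bar R :=
  match n with
  | 0 => (f [::])%:E
  | n'.+1 => (\int[@lebesgue_measure R]_x iter_int n' (fun s => f (x :: s)))%E
  end.

Definition int_RN (N : nat) (f : 'rV[R]_N -> R) : \bar R :=
  iter_int N (fun s => f (\row_(i < N) nth 0 s i)).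

Definition in_A (N : nat) (x : 'rV[R]_N) : bool :=
  [forall i : 'I_N, (-1 <= x ord0 i <= 1)] &&
  [forall i : 'I_N, forall j : 'I_N, (i <= j)%N ==> (x ord0 i <= x ord0 j)].

Definition jacobi_weight (N : nat) (a b kappa : R) (x : 'rV[R]_N) : R :=
  if in_A x then
    (\prod_(i < N) \prod_(j < N | (i < j)%N) (x ord0 j - x ord0 i) `^ kappa) *
    \prod_(i < N) ((1 - x ord0 i) `^ (kappa * (a + b) / 2 - 2^-1) *
                   (1 + x ord0 i) `^ (kappa * b / 2 - 2^-1))
  else 0.

Definition jacobi_expect (N : nat) (a b kappa : R) (f : 'rV[R]_N -> R) : R :=
  fine (@int_RN N (fun x => f x * jacobi_weight a b kappa x)) /
  fine (@int_RN N (jacobi_weight a b kappa)).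

Definition normal_density (N : nat) (Sigma : 'M[R]_N) (y : 'rV[R]_N) : R :=
  (Num.sqrt ((2 * pi) ^+ N * \det Sigma))^-1 *
  expR (- ((y *m invmx Sigma *m y^T) ord0 ord0) / 2).

Definition normal_expect (N : nat) (Sigma : 'M[R]_N) (f : 'rV[R]_N -> R) : R :=
  fine (@int_RN N (fun y => f y * normal_density Sigma y)).

Definition S_mat (N : nat) (a b : R) (z : 'rV[R]_N) : 'M[R]_N :=
  \matrix_(i < N, j < N)
    if i == j then
      \sum_(l < N | l != j) ((z ord0 j - z ord0 l) ^+ 2)^-1
      + (a + b) / 2 * ((1 - z ord0 j) ^+ 2)^-1
      + b / 2 * ((1 + z ord0 j) ^+ 2)^-1
    else - ((z ord0 i - z ord0 j) ^+ 2)^-1.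

End Defs.

(* Main.v *)
(** Laplace's method. On [A] the weight is [exp (kappa W)] up to exponents bounded
    in [kappa], where [W x = sum_(i<j) ln (x_j - x_i) + (a+b)/2 sum_i ln (1 - x_i)
    + b/2 sum_i ln (1 + x_i)]. The Jacobi differential equation, evaluated at the
    zeros of the polynomial, says that [z] is a critical point of [W], and [- W'' z]
    is the matrix [S]. Every logarithm in [W] has its argument in [0, 2], where
    [ln'' <= - 1/4]; hence the density of [sqrt kappa (X - z)], divided by its value
    at [0], lies below a Gaussian that does not depend on [kappa], while it tends
    pointwise to [exp (- y S y^T / 2)]. Dominated convergence gives the limits of the
    numerator and of the normalizing constant, and the limit of the latter is
    computed by completing the square one variable at a time. *)

Require Import Defs.
From HB Require Import structures.
From mathcomp Require Import all_boot all_order all_algebra.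
From mathcomp Require Import all_classical all_reals all_analysis.
From mathcomp Require Import measurable_realfun.
From mathcomp Require Import ring lra.
Import Order.TTheory GRing.Theory Num.Theory.
Import numFieldNormedType.Exports.
Local Open Scope classical_set_scope.
Local Open Scope ring_scope.

Set Implicit Arguments.
Unset Strict Implicit.
Unset Printing Implicit Defensive.

(** * Zeros of Jacobi polynomials *)

(** The obstacle is measurability: an iterated integral only makes sense step by step, so every
    inner integral must be measurable in the outer variable. This is drawn from continuity, which
    asks for integrands continuous on the whole space and for a majorant that is a product of
    functions of one coordinate, so that it survives fixing coordinates. The weight, extended by
    zero outside [A], is continuous once all its exponents are positive, hence the restriction to
    [kappa * b >= 2], harmless for the limit. The majorant comes from a quadratic bound on [ln]
    valid on all of []0, 2]] with one constant, so no splitting into a neighbourhood of [z] and its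
    complement occurs. The exponents [- 1/2] spoil the exact cancellation of first-order terms at
    [z], but only by a linear term, which is bounded since [A] is bounded and so costs a constant
    factor. *)

Section Jacobi.
Context {R : realType}.
Implicit Types (al be x r : R) (N k m : nat).

Lemma gbinS r m : gbin r m.+1 * m.+1%:R = gbin r m * (r - m%:R).
Proof.
rewrite /gbin big_ord_recr /= factS natrM.
have m1 : m.+1%:R != 0 :> R by rewrite pnatr_eq0.
have mf : (m`!)%:R != 0 :> R by rewrite pnatr_eq0 -lt0n fact_gt0.
by field; rewrite mf nat1r m1.
Qed.

Lemma gbin_gt0 r m : m%:R - 1 < r -> 0 < gbin r m.
Proof.
move=> mr; rewrite /gbin divr_gt0 ?ltr0n ?fact_gt0//.
apply: prodr_gt0 => i _; rewrite subr_gt0 (le_lt_trans _ mr)//.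
by rewrite lerBrDr natr1 ler_nat.
Qed.

Let c N al be k : R := gbin (N%:R + al) (N - k) * gbin (N%:R + be) k.

Lemma jacobi_coefS N al be k : (k < N)%N ->
  c N al be k.+1 * (k.+1%:R * (k.+1%:R + al)) =
  c N al be k * ((N - k)%:R * ((N - k)%:R + be)).
Proof.
move=> kN; rewrite /c; have e : (N - k = (N - k.+1).+1)%N by rewrite subnSK.
have := gbinS (N%:R + al) (N - k.+1); rewrite -e => h1.
have := gbinS (N%:R + be) k => h2.
have -> : (N - k)%:R = N%:R - k%:R :> R by rewrite natrB// ltnW.
move: h1 h2; rewrite !natrB//; last exact: ltnW.
rewrite -natr1.
set A := gbin _ (N - k); set B := gbin _ k; set A' := gbin _ _; set B' := gbin _ _.
move=> h1 h2; transitivity ((B' * (k%:R + 1)) * (A' * (N%:R + al - (N%:R - (k%:R + 1))))); first by ring.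
by rewrite h2 -h1; ring.
Qed.

Let u x : R := (x - 1) / 2.
Let v x : R := (x + 1) / 2.

Let pu : {poly R} := (2^-1) *: ('X - 1).
Let pv : {poly R} := (2^-1) *: ('X + 1).

Let puE x : pu.[x] = u x. Proof. by rewrite /pu !hornerE mulrC. Qed.
Let pvE x : pv.[x] = v x. Proof. by rewrite /pv !hornerE mulrC. Qed.
Let pu' : pu^`() = (2^-1)%:P.
Proof. by rewrite /pu derivZ derivB derivX derivC subr0 alg_polyC. Qed.
Let pv' : pv^`() = (2^-1)%:P.
Proof. by rewrite /pv derivZ derivD derivX derivC addr0 alg_polyC. Qed.

Lemma deriv_monomial (p q : {poly R}) (h : R) k m : p^`() = h%:P -> q^`() = h%:P ->
  (p ^+ k * q ^+ m)^`() =
  h *: ((p ^+ k.-1 * q ^+ m) *+ k + (p ^+ k * q ^+ m.-1) *+ m).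
Proof.
move=> p' q'; rewrite derivM !deriv_exp p' q' !mul_polyC.
by rewrite mulrnAl mulrnAr -scalerAl -scalerAr scalerDr !scalerMnr.
Qed.

(** The relation [v - u = 1] makes the image homogeneous of degree [k + m] in [u] and [v]: only the
    monomial and its two neighbours appear. The truncated predecessors are harmless, since their
    coefficients vanish with [k] or [m]. *)
Lemma jacobi_monomial_ode al be k m x :
  (1 - x ^+ 2) * (pu ^+ k * pv ^+ m)^`()^`().[x]
  + (be - al - (al + be + 2) * x) * (pu ^+ k * pv ^+ m)^`().[x] =
  - (k%:R * (k%:R + al) * (u x ^+ k.-1 * v x ^+ m.+1)
     + (2 * k%:R * m%:R + (al + 1) * m%:R + (be + 1) * k%:R) * (u x ^+ k * v x ^+ m)
     + m%:R * (m%:R + be) * (u x ^+ k.+1 * v x ^+ m.-1)).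
Proof.
move: pu' pv' (puE x) (pvE x); move: pu pv => p q p' q' pE qE.
rewrite !(fun k m => deriv_monomial k m p' q') derivZ derivD !derivMn !(fun k m => deriv_monomial k m p' q').
rewrite !(hornerMn, hornerZ, hornerD, hornerM, horner_exp) pE qE {pE qE p' q'}.
have : v x = u x + 1 by rewrite /u /v; field.
have : x = 2 * u x + 1 by rewrite /u; field.
move: (u x) (v x) => U V -> ->.
case: k m => [|[|k]] [|[|m]] /=; rewrite ?exprS ?expr0 -?natr1; by field.
Qed.

(** Since [N = (N - k) + k], the eigenvalue term leaves [k (k + al) + m (m + be)], with [m = N - k],
    on the middle monomial. By the recurrence [jacobi_coefS] these two pieces cancel the
    neighbouring monomials produced by [k + 1] and [k - 1]. *)
Lemma jacobi_ode N al be x :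
  (1 - x ^+ 2) * (jacobi N al be)^`()^`().[x]
  + (be - al - (al + be + 2) * x) * (jacobi N al be)^`().[x]
  + N%:R * (N%:R + al + be + 1) * (jacobi N al be).[x] = 0.
Proof.
pose d k := c N al be k * (k%:R * (k%:R + al)).
pose F k := d k * (u x ^+ k.-1 * v x ^+ (N - k).+1).
pose G k := d k * (u x ^+ k * v x ^+ (N - k)).
have dN k : (k <= N)%N -> (if k == N then 0 else d k.+1) =
    c N al be k * ((N - k)%:R * ((N - k)%:R + be)).
  rewrite leq_eqVlt; case: eqP => [->|_] /=; first by rewrite subnn mul0r mulr0.
  exact: jacobi_coefS.
(* The cut at [k = N] is needed: the formula for the coefficients does not vanish at [N + 1] in
   general. At the other end [d 0 = 0], so the shifted sums agree with the original ones. *)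
pose F' k := if k == N then 0 else F k.+1.
pose G' k := if k == N then 0 else G k.+1.
transitivity (\sum_(k < N.+1) ((F' k - F k) + (G k - G' k))).
  have dsum (H : 'I_N.+1 -> {poly R}) : (\sum_k H k)^`() = \sum_k (H k)^`().
    exact: raddf_sum.
  rewrite /jacobi !dsum !horner_sum !mulr_sumr -!big_split /=.
  apply: eq_bigr => k _; have kN : (k <= N)%N by rewrite -ltnS.
  rewrite -/pu -/pv !derivZ !hornerZ -/(c N al be k).
  rewrite -!(mulrCA (c _ _ _ _)) -!mulrDr jacobi_monomial_ode.
  rewrite hornerM !horner_exp puE pvE.
  have -> : F' k = c N al be k * ((N - k)%:R * ((N - k)%:R + be)) * (u x ^+ k * v x ^+ (N - k)).
    rewrite -dN// /F' /F; case: eqP => [_|/eqP kN']; first by rewrite mul0r.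
    by rewrite /= subnSK// ltn_neqAle kN'.
  have -> : G' k = c N al be k * ((N - k)%:R * ((N - k)%:R + be)) * (u x ^+ k.+1 * v x ^+ (N - k).-1).
    rewrite -dN// /G' /G; case: eqP => [_|/eqP kN']; first by rewrite mul0r.
    by rewrite -subnS.
  rewrite /F /G /d; have -> : N%:R = (N - k)%:R + k%:R :> R by rewrite -natrD subnK.
  by set m := (N - k)%N; ring.
rewrite big_split/= !sumrB.
have shift (H : nat -> R) : H 0%N = 0 ->
    \sum_(k < N.+1) (if k == N :> nat then 0 else H k.+1) = \sum_(k < N.+1) H k.
  move=> H0; rewrite big_ord_recr/= eqxx addr0 big_ord_recl H0 add0r.
  by apply: eq_bigr => i _; rewrite ltn_eqF.
by rewrite !shift /F /G /d ?mul0r ?mulr0 ?mul0r// !subrr addr0.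
Qed.

Lemma jacobi_coef_gt0 N al be k : -1 < al -> -1 < be -> (k <= N)%N ->
  0 < gbin (N%:R + al) (N - k) * gbin (N%:R + be) k.
Proof.
move=> al1 be1 kN; rewrite mulr_gt0// gbin_gt0//.
  have : (N - k)%:R <= N%:R :> R by rewrite ler_nat leq_subr.
  by lra.
have : k%:R <= N%:R :> R by rewrite ler_nat.
by lra.
Qed.

Lemma horner_jacobi N al be x : (jacobi N al be).[x] =
  \sum_(k < N.+1) gbin (N%:R + al) (N - k) * gbin (N%:R + be) k *
    (((x - 1) / 2) ^+ k * ((x + 1) / 2) ^+ (N - k)).
Proof.
rewrite /jacobi horner_sum; apply: eq_bigr => k _.
by rewrite hornerZ hornerM !horner_exp -/pu -/pv puE pvE.
Qed.

(** Signs in the explicit sum locate the roots without orthogonality: for [x >= 1] no summand is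
    negative and the one with [k = 0] is positive. For [x <= -1] the same happens after
    multiplication by [(-1) ^+ N], with [k = N]. *)
Lemma jacobi_gt0 N al be x : -1 < al -> -1 < be -> 1 <= x ->
  0 < (jacobi N al be).[x].
Proof.
move=> al1 be1 x1; rewrite horner_jacobi big_ord_recl /=.
apply: ltr_pwDl; last first.
  apply: sumr_ge0 => k _; apply: mulr_ge0; first exact/ltW/jacobi_coef_gt0.
  by rewrite mulr_ge0// exprn_ge0//; lra.
apply: mulr_gt0; first exact: jacobi_coef_gt0.
by rewrite expr0 mul1r exprn_gt0//; lra.
Qed.

Lemma jacobi_sign_gt0 N al be x : -1 < al -> -1 < be -> x <= -1 ->
  0 < (-1) ^+ N * (jacobi N al be).[x].
Proof.
move=> al1 be1 x1; rewrite horner_jacobi mulr_sumr.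
have sgn k : (k <= N)%N -> (-1) ^+ N *
    (gbin (N%:R + al) (N - k) * gbin (N%:R + be) k *
      (((x - 1) / 2) ^+ k * ((x + 1) / 2) ^+ (N - k))) =
    gbin (N%:R + al) (N - k) * gbin (N%:R + be) k *
      ((- ((x - 1) / 2)) ^+ k * (- ((x + 1) / 2)) ^+ (N - k)).
  move=> kN; rewrite (exprNn ((x - 1) / 2)) (exprNn ((x + 1) / 2)).
  by rewrite -{1}(subnKC kN) exprD; ring.
rewrite big_ord_recr /= sgn//; apply: ltr_pwDr; last first.
  apply: sumr_ge0 => k _; rewrite sgn; last exact/ltnW.
  apply: mulr_ge0; first by apply/ltW/jacobi_coef_gt0 => //; exact/ltnW.
  by rewrite mulr_ge0// exprn_ge0//; lra.
apply: mulr_gt0; first exact: jacobi_coef_gt0.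
by rewrite subnn expr0 mulr1 exprn_gt0//; lra.
Qed.

Lemma jacobi_root_itv N al be x : -1 < al -> -1 < be ->
  root (jacobi N al be) x -> -1 < x < 1.
Proof.
move=> al1 be1 /rootP x0; apply/andP; split; rewrite ltNge; apply/negP => hx.
  by have := jacobi_sign_gt0 N al1 be1 hx; rewrite x0 mulr0 ltxx.
by have := jacobi_gt0 N al1 be1 hx; rewrite x0 ltxx.
Qed.

Lemma size_jacobi_le N al be : (size (jacobi N al be) <= N.+1)%N.
Proof.
rewrite /jacobi; apply: (leq_trans (size_sum _ _ _)); apply/bigmax_leqP => k _.
apply: leq_trans (size_scale_leq _ _) _.
have sz1 (h : {poly R}) n : (size h <= 2)%N -> (size (h ^+ n) <= n.+1)%N.
  move=> h2; apply: leq_trans (size_poly_exp_leq _ _) _; rewrite ltnS.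
  by case: (size h) h2 => [|[|[|]]]//= _; rewrite ?mul1n.
apply: leq_trans (size_polyMleq _ _) _.
have hk := sz1 pu k; have hm := sz1 pv (N - k)%N.
have {}hk : (size (pu ^+ k) <= k.+1)%N.
  by apply/hk/(leq_trans (size_scale_leq _ _)); rewrite -polyC1 size_XsubC.
have {}hm : (size (pv ^+ (N - k)) <= (N - k).+1)%N.
  by apply/hm/(leq_trans (size_scale_leq _ _)); rewrite -polyC1 size_XaddC.
have kN : (k <= N)%N by rewrite -ltnS.
rewrite -subn1 leq_subLR; apply: leq_trans (leq_add hk hm) _.
by rewrite addSn addnS subnKC.
Qed.

(** The leading coefficient is never computed: the polynomial is nonzero because it is positive at
    [1], and its [N] distinct roots force the degree bound [N] to be attained. *)
Lemma jacobi_prod_XsubC N al be (z : 'I_N -> R) : -1 < al -> -1 < be ->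
  injective z -> (forall i, root (jacobi N al be) (z i)) ->
  lead_coef (jacobi N al be) != 0 /\
  jacobi N al be = lead_coef (jacobi N al be) *: \prod_(i < N) ('X - (z i)%:P).
Proof.
move=> al1 be1 zI rz; set P := jacobi N al be.
have P0 : P != 0.
  by apply/eqP => P0; have := jacobi_gt0 N al1 be1 (lexx 1); rewrite -/P P0 horner0 ltxx.
split; first by rewrite lead_coef_eq0.
pose rs := [seq z i | i <- enum 'I_N].
have rrs : all (root P) rs by apply/allP => _ /mapP[i _ ->]; exact: rz.
have urs : uniq rs by rewrite map_inj_uniq// enum_uniq.
have szrs : size rs = N by rewrite size_map size_enum_ord.
have szP : size P = (size rs).+1.
  by apply/eqP; rewrite eqn_leq (max_poly_roots P0 rrs urs) andbT szrs size_jacobi_le.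
rewrite {1}(all_roots_prod_XsubC szP rrs); last by rewrite uniq_rootsE.
by congr (_ *: _); rewrite /rs big_map big_enum.
Qed.

Lemma log_deriv_prod_XsubC (I : eqType) (r : seq I) (Q : pred I) (z : I -> R) x :
  (forall i, Q i -> x != z i) ->
  (\prod_(i <- r | Q i) ('X - (z i)%:P))^`().[x] =
  (\prod_(i <- r | Q i) ('X - (z i)%:P)).[x] * \sum_(i <- r | Q i) (x - z i)^-1.
Proof.
move=> xz; elim: r => [|i r IH]; first by rewrite !big_nil derivC horner0 mulr0.
rewrite !big_cons; case: ifP => // Qi.
rewrite derivM derivXsubC mul1r hornerD !hornerM IH !hornerXsubC mulrDr.
by congr (_ + _); rewrite ?mulrA// mulrAC divff ?mul1r// subr_eq0 xz.
Qed.

(* The Stieltjes relations: at a zero of P the differential equation reads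
   (1 - x^2) P'' = ((al + be + 2) x - (be - al)) P'. *)
Lemma jacobi_zeros_stieltjes N al be (z : 'I_N -> R) i : -1 < al -> -1 < be ->
  injective z -> (forall i, root (jacobi N al be) (z i)) ->
  \sum_(l < N | l != i) (z i - z l)^-1 =
  (al + 1) / 2 / (1 - z i) - (be + 1) / 2 / (1 + z i).
Proof.
move=> al1 be1 zI rz; have [c0 Pz] := jacobi_prod_XsubC al1 be1 zI rz.
have /andP[zi1 zi2] := jacobi_root_itv al1 be1 (rz i).
pose Q : {poly R} := \prod_(l < N | l != i) ('X - (z l)%:P).
have xz l : l != i -> z i != z l.
  by apply: contra => /eqP/zI ->.
have Q0 : Q.[z i] != 0.
  rewrite /Q horner_prod; by apply/prodf_neq0 => l /xz; rewrite hornerXsubC subr_eq0.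
(* With [P = c (X - z_i) Q], one has [P'(z_i) = c Q(z_i)] and [P''(z_i) = 2 c Q'(z_i)], and [Q' / Q]
   at [z_i] is the sum sought. *)
have := jacobi_ode N al be (z i).
rewrite (rootP (rz i)) mulr0 addr0 Pz (bigD1 i)//= -/Q !derivZ !hornerZ.
rewrite derivM derivXsubC mul1r derivD derivM derivXsubC mul1r.
rewrite !hornerD !hornerM !hornerXsubC subrr !mul0r !addr0.
rewrite log_deriv_prod_XsubC// -/Q.
set s := \sum_(_ < _ | _) _; move: (lead_coef _) c0 => c' c0 E.
have {}E : c' * Q.[z i] * ((1 - z i ^+ 2) * (2 * s) + (be - al - (al + be + 2) * z i)) = 0.
  by rewrite -[RHS]E; ring.
move/eqP: E; rewrite !mulf_eq0 (negbTE c0) (negbTE Q0) /= => /eqP E.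
have h1 : 1 - z i != 0 by rewrite subr_eq0 gt_eqF.
have h2 : 1 + z i != 0 by rewrite addrC -(opprK 1) subr_eq0 gt_eqF.
apply: (mulfI h1); apply: (mulfI h2).
have -> : (1 + z i) * ((1 - z i) * s) = ((1 - z i ^+ 2) * (2 * s)) / 2 by field.
by rewrite (eqP (_ : (1 - z i ^+ 2) * (2 * s) == - (be - al - (al + be + 2) * z i))) -?addr_eq0 ?E//; field; rewrite h1 h2.
Qed.

End Jacobi.

(** * Iterated Lebesgue integrals *)

Section IteratedIntegrals.
Context {R : realType}.
Notation mu := (@lebesgue_measure R).
Implicit Types (F G : seq R -> R) (C c x : R) (n : nat).

(** Lebesgue measure is [c] times its own image under [x |-> t + c * x]; by uniqueness this need
    only be checked on half-open intervals. *)
Lemma ge0_integral_affine (f : R -> \bar R) (t c : R) : 0 < c ->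
  measurable_fun setT f -> (forall x, 0 <= f x)%E ->
  (\int[mu]_x f x = c%:E * \int[mu]_x f (t + c * x)%R)%E.
Proof.
move=> c0 mf f0; pose phi (x : R) : R := t + c * x.
have mphi : measurable_fun [set: R] phi.
  apply: continuous_measurable_fun => x; rewrite /phi.
  by apply: cvgD; [exact: cvg_cst | apply: cvgM; [exact: cvg_cst | exact: cvg_id]].
pose k : {nonneg R} := NngNum (ltW c0).
pose psi : measurableTypeR R -> measurableTypeR R := phi.
have mpsi : measurable_fun setT psi by exact: mphi.
pose m2 : {measure set (measurableTypeR R) -> \bar R} := mscale k (pushforward mu psi).
rewrite (@eq_measure_integral _ _ _ _ (m2 mpsi)); last first.
  move=> A mA _; apply: lebesgue_measure_unique => // _ [[a b] _ <-] /=.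
  rewrite /m2 /mscale /= /pushforward.
  have -> : phi @^-1` `]a, b] = `]((a - t) / c), ((b - t) / c)]%classic.
    apply/seteqP; split => x /=; rewrite !in_itv/= /phi ltr_pdivrMr// ler_pdivlMr// => /andP[h1 h2].
      by apply/andP; split; lra.
    by apply/andP; split; lra.
  rewrite !lebesgue_measure_itv/= !lte_fin ltr_pM2r ?invr_gt0// ltrD2r.
  case: ifP => _; last by rewrite mule0.
  by rewrite -!EFinD -EFinM; congr EFin; field; rewrite gt_eqF.
rewrite /m2 ge0_integral_mscale//=.
by rewrite ge0_integral_pushforward.
Qed.

Lemma integrable_affine (f : R -> \bar R) (t c : R) : 0 < c ->
  mu.-integrable setT f -> mu.-integrable setT (fun x => f (t + c * x)).
Proof.
move=> c0 /integrableP[mf fi]; apply/integrableP; split.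
  have mphi : measurable_fun [set: R] (fun x : R => t + c * x).
    apply: continuous_measurable_fun => x.
    by apply: cvgD; [exact: cvg_cst | apply: cvgM; [exact: cvg_cst | exact: cvg_id]].
  exact: (measurableT_comp mf mphi).
move: fi; rewrite (ge0_integral_affine t c0)//; last exact: measurableT_comp.
apply: contraTT; rewrite -!leNgt !leye_eq => /eqP ->.
by rewrite gt0_muley ?lte_fin.
Qed.

Lemma integral_affine (f : R -> \bar R) (t c : R) : 0 < c ->
  mu.-integrable setT f ->
  (\int[mu]_x f x = c%:E * \int[mu]_x f (t + c * x)%R)%E.
Proof.
move=> c0 fi; have mf := measurable_int _ fi; have fi' := integrable_affine t c0 fi.
rewrite [LHS]integralE [X in (_ * X)%E]integralE.
rewrite (@ge0_integral_affine _ t c c0 (measurable_funepos mf))//.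
rewrite (@ge0_integral_affine _ t c c0 (measurable_funeneg mf))//.
rewrite [RHS]muleBr//.
  by congr (_ * _ - _ * _)%E; apply: eq_integral => x _; rewrite ?funeposE ?funenegE.
apply: fin_num_adde_defl; rewrite fin_numN.
exact: integrable_neg_fin_num.
Qed.

Lemma eq_iter_int n F G : (forall s, size s = n -> F s = G s) ->
  iter_int n F = iter_int n G.
Proof.
elim: n F G => [|n IH] F G FG /=; first by rewrite FG.
by apply: eq_integral => x _; apply: IH => s sn; rewrite FG//= sn.
Qed.

(** Continuity in each coordinate separately, with prefix [p] and suffix [s] frozen. It passes to
    slices, and it suffices because only the outer variable moves when an inner integral is tested
    for continuity. *)
Definition sepcont n F :=
  forall p s, (size p + size s).+1 = n -> continuous (fun x : R => F (p ++ x :: s)).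

Lemma sepcont_cons n F x : sepcont n.+1 F -> sepcont n (fun s => F (x :: s)).
Proof. by move=> Fc p s psn; apply: (Fc (x :: p)); rewrite /= addSn psn. Qed.

Definition dominated (g : R -> R) C n F :=
  forall s, size s = n -> `|F s| <= C * \prod_(x <- s) g x.

Fixpoint affine_seq (t : nat -> R) c (s : seq R) : seq R :=
  if s is x :: s' then t 0%N + c * x :: affine_seq (t \o succn) c s' else [::].

Lemma nth_affine_seq t c s i : (i < size s)%N ->
  nth 0 (affine_seq t c s) i = t i + c * nth 0 s i.
Proof. by elim: s t i => // x s IH t [|i] //= /IH ->. Qed.

Section Dominated.
Variable g : R -> R.
Hypothesis g01 : forall x, 0 <= g x <= 1.
Hypothesis gi : mu.-integrable setT (EFin \o g).

Let g0 x : 0 <= g x. Proof. by have /andP[] := g01 x. Qed.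
Let g1 x : g x <= 1. Proof. by have /andP[] := g01 x. Qed.
Let J := fine (\int[mu]_x (g x)%:E).

Let intg : (\int[mu]_x (g x)%:E = J%:E)%E.
Proof. by rewrite /J fineK//; exact: integrable_fin_num. Qed.

Let J0 : 0 <= J.
Proof. by rewrite /J fine_ge0// integral_ge0// => x _; rewrite lee_fin. Qed.

Lemma dominated_cons C n F x : dominated g C n.+1 F ->
  dominated g (C * g x) n (fun s => F (x :: s)).
Proof.
by move=> Fd s sn; apply: le_trans (Fd _ _) _; rewrite /= ?sn// big_cons mulrA.
Qed.

(** Forgetting the factor [g x] makes the constant independent of [x], as continuity of the inner
    integral in [x] requires; [dominated_cons] keeps that factor, for integrability in [x]. *)
Lemma dominated_cons1 C n F x : 0 <= C -> dominated g C n.+1 F ->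
  dominated g C n (fun s => F (x :: s)).
Proof.
move=> C0 Fd s sn; apply: le_trans (dominated_cons x Fd sn) _.
by rewrite ler_wpM2r ?prodr_ge0// ler_piMr.
Qed.

Let bounded_at n := forall F C, 0 <= C -> sepcont n F -> dominated g C n F ->
  (`|iter_int n F| <= (C * J ^+ n)%:E)%E.

Let cvg_at n := forall (F_ : nat -> seq R -> R) F C, 0 <= C ->
  (forall k, sepcont n (F_ k)) -> sepcont n F ->
  (forall k, dominated g C n (F_ k)) -> dominated g C n F ->
  (forall s, size s = n -> F_ k s @[k --> \oo] --> F s) ->
  fine (iter_int n (F_ k)) @[k --> \oo] --> fine (iter_int n F).

Let integrable_bound n C : mu.-integrable setT (fun x => (C * J ^+ n * g x)%:E).
Proof.
rewrite (_ : (fun _ => _) = (fun x => (C * J ^+ n)%:E * (EFin \o g) x)%E)//.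
exact: integrableZl.
Qed.

(* Measurability of the inner integral as a function of the outer variable comes
   from its continuity, itself a case of dominated convergence one dimension below. *)
Let slice n F C : bounded_at n -> cvg_at n -> 0 <= C ->
    sepcont n.+1 F -> dominated g C n.+1 F ->
  let Phi x := iter_int n (fun s => F (x :: s)) in
  [/\ forall x, (`|Phi x| <= (C * J ^+ n * g x)%:E)%E,
      forall x, Phi x \is a fin_num & mu.-integrable setT Phi].
Proof.
move=> IHb IHc C0 Fc Fd Phi.
have PhiB x : (`|Phi x| <= (C * J ^+ n * g x)%:E)%E.
  rewrite mulrAC; apply: IHb => //.
  - by rewrite mulr_ge0.
  - exact: sepcont_cons.
  - exact: dominated_cons.
have PhiF x : Phi x \is a fin_num.
  by rewrite fin_num_abs (le_lt_trans (PhiB x))// ltry.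
split=> //.
apply: (le_integrable measurableT _ _ (integrable_bound n C)).
- rewrite (_ : Phi = EFin \o (fun x => fine (Phi x))); last first.
    by apply/funext => x /=; rewrite fineK.
  apply/measurable_EFinP; apply: continuous_measurable_fun => x.
  apply/(@cvg_nbhsP _ R^o) => u ux.
  apply: (IHc _ _ C) => //.
  - by move=> k; apply: sepcont_cons.
  - exact: sepcont_cons.
  - by move=> k; apply: dominated_cons1.
  - exact: dominated_cons1.
  - move=> s sn; apply: (cvg_comp u (fun x => F (x :: s)) ux).
    by apply: (Fc [::]); rewrite /= add0n sn.
- move=> x _; apply: le_trans (PhiB x) _.
  by rewrite gee0_abs// lee_fin !mulr_ge0 ?exprn_ge0.
Qed.

(** Neither half can be proved alone by induction: [cvg_at n] yields measurability of the inner
    integral, [bounded_at n] its integrable majorant, and dimension [n.+1] needs both. *)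
Let iter_int_dominated n : bounded_at n /\ cvg_at n.
Proof.
elim: n => [|n [IHb IHc]].
  split=> [F C C0 _ Fd | F_ F C _ _ _ _ _ FF] /=; last exact: FF.
  by rewrite lee_fin expr0; have := Fd [::] erefl; rewrite big_nil.
have bound : bounded_at n.+1.
  move=> F C C0 Fc Fd /=; have [PhiB PhiF Phii] := slice IHb IHc C0 Fc Fd.
  have mPhi := measurable_int _ Phii.
  apply: le_trans (le_abse_integral _ _ _) _ => //.
  have -> : (C * J ^+ n.+1)%:E = (\int[mu]_x (C * J ^+ n * g x)%:E)%E.
    under eq_integral do rewrite EFinM.
    by rewrite integralZl// intg -EFinM exprSr mulrA.
  apply: ge0_le_integral => //.
  - exact: measurableT_comp.
  - by apply: measurable_int; exact: integrable_bound.
split=> // F_ F C C0 F_c Fc F_d Fd F_F.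
have [PhiB PhiF Phii] := slice IHb IHc C0 Fc Fd.
have Phik k := slice IHb IHc C0 (F_c k) (F_d k).
apply: fine_cvg; rewrite fineK; last first.
  by rewrite fin_num_abs (le_lt_trans (bound F C C0 Fc Fd))// ltry.
have [] := @dominated_convergence _ _ _ mu setT measurableT
  (fun k x => iter_int n (fun s => F_ k (x :: s)))
  (fun x => iter_int n (fun s => F (x :: s))) (fun x => (C * J ^+ n * g x)%:E) => //.
- by move=> k; have [_ _ /measurable_int] := Phik k.
- exact: measurable_int Phii.
- apply: aeW => x _; rewrite -(fineK (PhiF x)).
  apply: cvg_EFin; first by apply: nearW => k; have [_ + _] := Phik k; apply.
  apply: (IHc _ _ C) => //.
  - by move=> k; apply: sepcont_cons.
  - exact: sepcont_cons.
  - by move=> k; apply: dominated_cons1.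
  - exact: dominated_cons1.
  - by move=> s sn; apply: F_F; rewrite /= sn.
- by apply: aeW => x k _; have [+ _ _] := Phik k; apply.
Qed.

Lemma iter_int_cvg n : cvg_at n.
Proof. exact: (iter_int_dominated n).2. Qed.

Lemma iter_int_fin_num n F C : 0 <= C -> sepcont n F -> dominated g C n F ->
  iter_int n F \is a fin_num.
Proof.
move=> C0 Fc Fd; rewrite fin_num_abs.
by apply: le_lt_trans ((iter_int_dominated n).1 F C C0 Fc Fd) _; rewrite ltry.
Qed.

Lemma iter_int_integrable n F C : 0 <= C -> sepcont n.+1 F -> dominated g C n.+1 F ->
  mu.-integrable setT (fun x => iter_int n (fun s => F (x :: s))).
Proof.
by have [IHb IHc] := iter_int_dominated n; move=> C0 Fc /(slice IHb IHc C0 Fc)[].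
Qed.

Lemma iter_intZ n F C c : 0 <= C -> sepcont n F -> dominated g C n F ->
  (iter_int n (fun s => (c * F s)%R) = c%:E * iter_int n F)%E.
Proof.
elim: n F C => [|n IH] F C C0 Fc Fd /=; first by rewrite EFinM.
rewrite -integralZl//; last exact: iter_int_integrable Fd.
apply: eq_integral => x _; apply: (IH _ C) => //; first exact: sepcont_cons.
exact: dominated_cons1.
Qed.

Lemma iter_int_affine n F C (t : nat -> R) c : 0 < c -> 0 <= C ->
  sepcont n F -> dominated g C n F ->
  (iter_int n (fun s => F (affine_seq t c s)) = (c ^- n)%:E * iter_int n F)%E.
Proof.
move=> c0; elim: n F C t => [|n IH] F C t C0 Fc Fd.
  by rewrite expr0 invr1 mul1e.
have Fi := iter_int_integrable C0 Fc Fd.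
rewrite /= (integral_affine (t 0%N) c0 Fi) muleA -EFinM exprS invfM mulrAC.
rewrite mulVf ?gt_eqF// mul1r -integralZl//; last first.
  exact: (integrable_affine (t 0%N) c0 Fi).
apply: eq_integral => x _; apply: (IH _ C) => //; first exact: sepcont_cons.
exact: dominated_cons1.
Qed.

End Dominated.
End IteratedIntegrals.

(** * Limits of finite sums, finite products and matrices *)

Section Cvg.
Context {R : realType}.

Lemma cvgr_sum {T I : Type} (F : set_system T) {FF : Filter F} (r : seq I)
    (P : pred I) (f : I -> T -> R) (l : I -> R) :
  (forall i, P i -> f i x @[x --> F] --> l i) ->
  \sum_(i <- r | P i) f i x @[x --> F] --> \sum_(i <- r | P i) l i.
Proof.
move=> fl; elim: r => [|i r IH].
  by rewrite big_nil; under eq_fun do rewrite big_nil; exact: cvg_cst.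
rewrite big_cons; under eq_fun do rewrite big_cons.
by case: ifP => // Pi; apply: cvgD => //; exact: fl.
Qed.

Lemma cvgr_prod {T I : Type} (F : set_system T) {FF : Filter F} (r : seq I)
    (P : pred I) (f : I -> T -> R) (l : I -> R) :
  (forall i, P i -> f i x @[x --> F] --> l i) ->
  \prod_(i <- r | P i) f i x @[x --> F] --> \prod_(i <- r | P i) l i.
Proof.
move=> fl; elim: r => [|i r IH].
  by rewrite big_nil; under eq_fun do rewrite big_nil; exact: cvg_cst.
rewrite big_cons; under eq_fun do rewrite big_cons.
by case: ifP => // Pi; apply: cvgM => //; exact: fl.
Qed.

Lemma cvg_mx {T : Type} m n (F : set_system T) {FF : Filter F}
    (f : T -> 'M[R]_(m, n)) (M : 'M[R]_(m, n)) :
  (forall i j, f x i j @[x --> F] --> M i j) -> f x @[x --> F] --> M.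
Proof.
move=> fM A [P MP sPA]; rewrite /nbhs /=.
have : \forall x \near F, forall i j, P i j (f x i j).
  by apply: filter_forall => i; apply: filter_forall => j; apply: fM; exact: MP.
by apply: filterS => x Px; apply: sPA.
Qed.

Lemma continuous_mulr {T : topologicalType} (f h : T -> R) :
  continuous f -> continuous h -> continuous (fun y => f y * h y).
Proof. by move=> fc hc y; apply: (@continuousM R T f h y (fc y) (hc y)). Qed.

End Cvg.

(** * Integrals over row vectors and one-dimensional Gaussians *)

Section IntRN.
Context {R : realType}.
Notation mu := (@lebesgue_measure R).
Implicit Types (N : nat) (C c : R).

Definition row_of_seq N (s : seq R) : 'rV[R]_N := \row_(i < N) nth 0 s i.

Lemma sepcont_row N (G : 'rV[R]_N -> R) :
  continuous G -> sepcont N (fun s => G (row_of_seq N s)).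
Proof.
move=> Gc p s ps x; apply: (cvg_comp (fun x => row_of_seq N (p ++ x :: s))); last exact: Gc.
apply: cvg_mx => i j; rewrite mxE; under eq_fun do rewrite mxE.
under eq_fun do rewrite nth_cat; rewrite nth_cat.
case: ltnP => _; first exact: cvg_cst.
by case: (j - size p)%N => [|k] /=; [exact: cvg_id | exact: cvg_cst].
Qed.

Definition gdominated (g : R -> R) C N (G : 'rV[R]_N -> R) :=
  forall y, `|G y| <= C * \prod_(i < N) g (y ord0 i).

Lemma dominated_row (g : R -> R) C N (G : 'rV[R]_N -> R) : gdominated g C G ->
  dominated g C N (fun s => G (row_of_seq N s)).
Proof.
move=> Gd s sN; apply: le_trans (Gd _) _; rewrite (big_nth 0) big_mkord sN.
by under eq_bigr do rewrite mxE.
Qed.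

Section Dominated.
Variable g : R -> R.
Hypothesis g01 : forall x, 0 <= g x <= 1.
Hypothesis gi : mu.-integrable setT (EFin \o g).

Lemma int_RN_cvg N (G_ : nat -> 'rV[R]_N -> R) (G : 'rV[R]_N -> R) C : 0 <= C ->
  (forall k, continuous (G_ k)) -> continuous G ->
  (forall k, gdominated g C (G_ k)) -> gdominated g C G ->
  (forall y, G_ k y @[k --> \oo] --> G y) ->
  fine (int_RN (G_ k)) @[k --> \oo] --> fine (int_RN G).
Proof.
move=> C0 G_c Gc G_d Gd GG; apply: (iter_int_cvg g01 gi C0).
- by move=> k; exact: sepcont_row.
- exact: sepcont_row.
- by move=> k; exact: dominated_row.
- exact: dominated_row.
- by move=> s _; exact: GG.
Qed.

Lemma int_RN_fin_num N (G : 'rV[R]_N -> R) C : 0 <= C -> continuous G ->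
  gdominated g C G -> int_RN G \is a fin_num.
Proof.
move=> C0 Gc Gd; apply: (iter_int_fin_num g01 gi C0).
  exact: sepcont_row.
exact: dominated_row.
Qed.

Lemma int_RNZ N (G : 'rV[R]_N -> R) C c : 0 <= C -> continuous G ->
  gdominated g C G -> (int_RN (fun y => (c * G y)%R) = c%:E * int_RN G)%E.
Proof.
move=> C0 Gc Gd; apply: (iter_intZ g01 gi c C0 (sepcont_row Gc)).
exact: dominated_row.
Qed.

Lemma int_RN_affine N (G : 'rV[R]_N -> R) C (t : 'rV[R]_N) c : 0 < c -> 0 <= C ->
  continuous G -> gdominated g C G ->
  int_RN (fun y => G (t + c *: y)) = ((c ^- N)%:E * int_RN G)%E.
Proof.
move=> c0 C0 Gc Gd; pose t' i := if insub i is Some j then t ord0 j else 0.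
rewrite [X in (_ * X)%E]/int_RN -(iter_int_affine g01 gi t' c0 C0 (sepcont_row Gc)); last first.
  exact: dominated_row.
apply: eq_iter_int => s sN; congr (G _).
apply/rowP => i; rewrite !mxE nth_affine_seq ?sN// /t' insubT//= => iN.
by congr (t _ _ + _); exact: val_inj.
Qed.

End Dominated.

Lemma eq_int_RN N (F G : 'rV[R]_N -> R) : F =1 G -> int_RN F = int_RN G.
Proof. by move=> FG; apply: eq_iter_int => s _; exact: FG. Qed.

Lemma int_RN0 (F : 'rV[R]_0 -> R) : int_RN F = (F 0)%:E.
Proof. by rewrite /int_RN /=; congr (F _)%:E; apply/rowP => -[]. Qed.

Lemma int_RNS N (G : 'rV[R]_(1 + N) -> R) :
  (int_RN G = \int[mu]_x int_RN (fun r : 'rV[R]_N => G (row_mx x%:M r)))%E.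
Proof.
rewrite /int_RN /=; apply: eq_integral => x _; apply: eq_iter_int => s _.
congr (G _); apply/rowP => i; rewrite !mxE; case: splitP => j ->.
  by rewrite ord1 !mxE.
by rewrite !mxE.
Qed.

Lemma integrable_gaussian c : 0 < c ->
  mu.-integrable setT (EFin \o (fun x : R => expR (- (c * x ^+ 2)))).
Proof.
move=> c0; have s0 : 0 < Num.sqrt c by rewrite sqrtr_gt0.
have := integrable_affine 0 s0 (@integrableT_gauss R).
rewrite (_ : (fun x => _) = EFin \o (fun x : R => expR (- (c * x ^+ 2))))//.
apply/funext => x /=; rewrite /gauss_fun add0r exprMn sqr_sqrtr//.
exact: ltW.
Qed.

Lemma gaussian_itv c (x : R) : 0 < c -> 0 <= expR (- (c * x ^+ 2)) <= 1.
Proof.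
by move=> c0; rewrite expR_ge0 expR_le1 oppr_le0 mulr_ge0 ?sqr_ge0// ltW.
Qed.

Lemma integral_gaussian c : 0 < c ->
  (\int[mu]_x (expR (- (c * x ^+ 2)))%:E = (Num.sqrt (pi / c))%:E)%E.
Proof.
move=> c0; have s0 : 0 < Num.sqrt c by rewrite sqrtr_gt0.
have := integral_affine 0 s0 (@integrableT_gauss R).
rewrite /= integralT_gauss.
under [X in _ = (_ * X)%E -> _]eq_integral => x _.
  rewrite /gauss_fun add0r exprMn sqr_sqrtr; last exact: ltW.
  over.
set I := (\int[mu]_x _)%E => E.
have If : I \is a fin_num by apply: integrable_fin_num => //; exact: integrable_gaussian.
move: E; rewrite -(fineK If) -EFinM => -[E]; congr EFin.
rewrite sqrtrM ?pi_ge0// sqrtrV ?(ltW c0)// E mulrAC mulfV ?mul1r//.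
by rewrite gt_eqF.
Qed.

End IntRN.

(** * The multivariate Gaussian integral *)

Section GaussianIntegral.
Context {R : realType}.
Notation mu := (@lebesgue_measure R).

Definition qform N (S : 'M[R]_N) (y : 'rV[R]_N) : R := (y *m S *m y^T) ord0 ord0.

Definition sqnorm N (y : 'rV[R]_N) : R := \sum_(i < N) y ord0 i ^+ 2.

Lemma sqnorm_ge0 N (y : 'rV[R]_N) : 0 <= sqnorm y.
Proof. by apply: sumr_ge0 => i _; exact: sqr_ge0. Qed.

Lemma expR_sqnorm N c (y : 'rV[R]_N) :
  expR (- (c * sqnorm y)) = \prod_(i < N) expR (- (c * y ord0 i ^+ 2)).
Proof. by rewrite -expR_sum sumrN mulr_sumr. Qed.

Lemma sqnorm_row_mx N (x : R) (r : 'rV[R]_N) :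
  sqnorm (row_mx x%:M r) = x ^+ 2 + sqnorm r.
Proof.
rewrite /sqnorm big_split_ord /= big_ord1 row_mxEl mxE eqxx mulr1n; congr (_ + _).
by apply: eq_bigr => i _; rewrite row_mxEr.
Qed.

Lemma qformE N (S : 'M[R]_N) y :
  qform S y = \sum_(j < N) (\sum_(i < N) y ord0 i * S i j) * y ord0 j.
Proof. by rewrite /qform mxE; apply: eq_bigr => j _; rewrite !mxE. Qed.

Lemma continuous_qform N (S : 'M[R]_N) : continuous (qform S).
Proof.
move=> y; rewrite /continuous_at qformE (_ : qform S = fun y =>
    \sum_(j < N) (\sum_(i < N) y ord0 i * S i j) * y ord0 j); last first.
  by apply/funext => z; exact: qformE.
apply: (cvgr_sum (F := nbhs y)) => j _; apply: cvgM; last exact: coord_continuous.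
apply: (cvgr_sum (F := nbhs y)) => i _; apply: cvgM; last exact: cvg_cst.
exact: coord_continuous.
Qed.

Lemma continuous_expR_qform N (S : 'M[R]_N) : continuous (fun y => expR (- qform S y / 2)).
Proof.
move=> y; apply: (@continuous_comp _ _ _ (fun y => - qform S y / 2) expR).
  apply: continuousM; last exact: cst_continuous.
  by apply: continuousN; exact: continuous_qform.
exact: continuous_expR.
Qed.

Lemma gdominated_expR_qform N (S : 'M[R]_N) c : (forall y, c * sqnorm y <= qform S y) ->
  gdominated (fun x => expR (- (c / 2 * x ^+ 2))) 1 (fun y => expR (- qform S y / 2)).
Proof.
move=> cS y; rewrite mul1r -expR_sqnorm ger0_norm ?expR_ge0// ler_expR.
by have := cS y; lra.
Qed.

(** Write [S] in blocks [s], [v], [v^T], [T] and solve [w T = v]. Then the form at [(x, r)] is that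
    of [T] at [x w + r] plus [sg x^2], where [sg = s - w v^T] is the Schur complement. A translation
    in [r] removes [x w], and both the integral and the determinant split off a factor governed by
    [sg]. Positivity of the determinant belongs to the induction because [w] exists only when [T] is
    invertible. *)
Lemma int_RN_gaussian N (S : 'M[R]_N) c : 0 < c -> S^T = S ->
  (forall y, c * sqnorm y <= qform S y) ->
  0 < \det S /\
  int_RN (fun y => expR (- qform S y / 2)) = (Num.sqrt ((2 * pi) ^+ N / \det S))%:E.
Proof.
move=> c0; elim: N S => [|N IH] S.
  move=> _ _; rewrite det_mx00; split=> //; rewrite int_RN0 expr0 divr1 sqrtr1.
  by rewrite /qform mxE big_ord0 oppr0 mul0r expR0.
rewrite -[N.+1]/(1 + N)%N in S *; move=> Ssym cS.
pose s := S ord0 ord0; pose v : 'rV[R]_N := ursubmx S; pose T : 'M[R]_N := drsubmx S.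
have SE : S = block_mx s%:M v v^T T.
  rewrite -[LHS]submxK; congr block_mx.
    by apply/matrixP => i j; rewrite !ord1 !mxE eqxx mulr1n /s; congr (S _ _); apply: val_inj.
  by rewrite -{1}Ssym -trmx_ursub.
have Tsym : T^T = T by rewrite /T trmx_drsub Ssym.
have qrow x (r : 'rV[R]_N) : qform S (row_mx x%:M r) =
    x ^+ 2 * s + 2 * x * (v *m r^T) ord0 ord0 + qform T r.
  rewrite /qform {1}SE mul_row_block tr_row_mx mul_row_col tr_scalar_mx !mulmxDl.
  have -> : r *m v^T = (v *m r^T)^T by rewrite trmx_mul trmxK.
  rewrite !mul_scalar_mx !mul_mx_scalar -!scalemxAl.
  move: (v *m r^T) (r *m T *m r^T) => P Q.
  by rewrite !mxE eqxx mulr1n; ring.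
have cT r : c * sqnorm r <= qform T r.
  have := cS (row_mx 0%:M r); rewrite sqnorm_row_mx qrow.
  by rewrite expr0n /= mul0r mulr0 mul0r !add0r.
have [T0 IT] := IH T Tsym cT.
have Tu : T \in unitmx by rewrite unitmxE unitfE gt_eqF.
have [w wT] : exists w : 'rV[R]_N, w *m T = v by exists (v *m invmx T); rewrite mulmxKV.
pose sg := s - (w *m v^T) ord0 ord0.
have qsq x (r : 'rV[R]_N) : qform S (row_mx x%:M r) = qform T (x *: w + r) + x ^+ 2 * sg.
  have Tw : T *m w^T = v^T by rewrite -[T in LHS]Tsym -trmx_mul wT.
  have rv : r *m v^T = (v *m r^T)^T by rewrite trmx_mul trmxK.
  have vw : v *m w^T = (w *m v^T)^T by rewrite trmx_mul trmxK.
  rewrite qrow /qform /sg linearD linearZ /= !mulmxDl !mulmxDr -!scalemxAl -!scalemxAr wT.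
  rewrite -(mulmxA r T w^T) Tw rv vw.
  move: (v *m r^T) (r *m T *m r^T) (w *m v^T) => P Q V.
  by rewrite !mxE; ring.
(* At the vector [(1, - w)] the part coming from [T] vanishes, so the form equals [sg] there. *)
have sg0 : 0 < sg.
  have := cS (row_mx 1%:M (- w)); rewrite qsq sqnorm_row_mx scale1r subrr.
  rewrite [qform T 0]/qform !mul0mx mxE add0r expr1n mul1r => h.
  apply: lt_le_trans h; rewrite mulr_gt0// ltr_pwDl//.
  exact: sqnorm_ge0.
have detS : \det S = sg * \det T.
  (* Block elimination of the upper right corner: a unipotent factor times a lower triangular
     one. *)
  have -> : S = block_mx 1%:M w 0 1%:M *m block_mx sg%:M 0 v^T T.
    rewrite mulmx_block !mul1mx !mul0mx !add0r wT SE; congr block_mx.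
    by apply/matrixP => i j; rewrite !ord1 !mxE eqxx !mulr1n /sg !mxE subrK.
  by rewrite det_mulmx det_ublock !det1 !mul1r det_lblock det_scalar1.
split; first by rewrite detS mulr_gt0.
rewrite int_RNS.
pose g (x : R) := expR (- (c / 2 * x ^+ 2)).
have c2 : 0 < c / 2 by rewrite divr_gt0.
have inner x : int_RN (fun r : 'rV[R]_N => expR (- qform S (row_mx x%:M r) / 2)) =
    ((Num.sqrt ((2 * pi) ^+ N / \det T))%:E * (expR (- (sg / 2 * x ^+ 2)))%:E)%E.
  pose G (r : 'rV[R]_N) := expR (- (sg / 2 * x ^+ 2)) * expR (- qform T r / 2).
  have gi := integrable_gaussian c2.
  have Gc := @continuous_expR_qform _ T.
  have Gd := gdominated_expR_qform cT.
  have e1 : expR (- (sg / 2 * x ^+ 2)) <= 1.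
    by have /andP[] := @gaussian_itv R (sg / 2) x (divr_gt0 sg0 (ltr0Sn _ 1)).
  transitivity (int_RN (fun r => G (x *: w + 1 *: r))).
    by apply: eq_int_RN => r; rewrite scale1r /G -expRD qsq; congr expR; field.
  rewrite (int_RN_affine (fun x => gaussian_itv x c2) gi (C := 1))//; first last.
  - move=> r; rewrite normrM; apply: le_trans (Gd r).
    by rewrite ler_piMl// ger0_norm ?expR_ge0.
  - by apply: continuous_mulr => // r; exact: cst_continuous.
  rewrite expr1n invr1 mul1e (int_RNZ (fun x => gaussian_itv x c2) gi _ (C := 1))//.
  by rewrite IT muleC.
under eq_integral do rewrite inner.
have sg2 : 0 < sg / 2 by rewrite divr_gt0.
rewrite integralZl//; last exact: integrable_gaussian.
rewrite integral_gaussian// -EFinM -sqrtrM; last first.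
  by rewrite divr_ge0 ?exprn_ge0 ?mulr_ge0 ?pi_ge0// ltW.
congr (Num.sqrt _)%:E; rewrite detS exprS; field.
by rewrite !gt_eqF.
Qed.

End GaussianIntegral.

(** * Bounds for the logarithm and limits of single factors of the weight *)

Section RealLemmas.
Context {R : realType}.
Implicit Types (m d p s t u v w : R).

Lemma is_derive_ln_quad (al be v w : R) : 0 < w ->
  is_derive w 1 (fun w => ln w - al * w + be * (w - v) ^+ 2)
    (w^-1 - al + be * (2 * (w - v))).
Proof.
move=> w0; have dl := is_derive1_ln w0.
apply: is_derive_eq.
rewrite /GRing.scale /=; ring.
Qed.

Lemma continuous_ln_quad (al be v w : R) : 0 < w ->
  {for w, continuous (fun w => ln w - al * w + be * (w - v) ^+ 2)}.
Proof.
move=> w0; apply: differentiable_continuous; apply/derivable1_diffP.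
by apply: ex_derive; exact: is_derive_ln_quad.
Qed.

(** One mean value statement, for [u] and [v] in either order, serves both the global bound
    ([al = 1/v], [be = 1/8], centre [v]) and the local expansion ([al = 1], [be = 1/2], centre
    [1]). *)
Lemma ln_quad_MVT (al be c u v : R) : 0 < u -> 0 < v ->
  exists w, [/\ Num.min u v <= w <= Num.max u v &
    (ln u - al * u + be * (u - c) ^+ 2) - (ln v - al * v + be * (v - c) ^+ 2) =
    (w^-1 - al + be * (2 * (w - c))) * (u - v)].
Proof.
pose f w := ln w - al * w + be * (w - c) ^+ 2.
pose f' w := w^-1 - al + be * (2 * (w - c)).
have key (x y : R) : 0 < x -> x <= y ->
    exists2 w, x <= w <= y & f y - f x = f' w * (y - x).
  move=> x0 xy; have [||w] := @MVT_segment R f f' x y xy.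
  - move=> w /andP[]; rewrite !bnd_simp => xw _.
    by apply: is_derive_ln_quad; exact: lt_trans xw.
  - apply: continuous_in_subspaceT => w; rewrite inE /= in_itv /= => /andP[xw _].
    by apply: continuous_ln_quad; exact: lt_le_trans xw.
  by rewrite in_itv /= => xwy E; exists w.
move=> u0 v0; have [uv|/ltW vu] := leP u v.
  have [w uwv E] := key u v u0 uv; exists w; split; first by [].
  by rewrite -/(f u) -/(f v) -/(f' w) -(opprB v u) mulrN -E opprB.
by have [w uwv E] := key v u v0 vu; exists w.
Qed.

(** A first-order argument suffices: the derivative of the difference of the two sides factors as
    [- (w - v) (1 / (w v) - 1/4)]. Here [w v <= 4], and [w - v] has the sign of [u - v]. *)
Lemma ln_le_quad u v : 0 < u <= 2 -> 0 < v <= 2 ->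
  ln u <= ln v + (u - v) / v - (u - v) ^+ 2 / 8.
Proof.
move=> /andP[u0 u2] /andP[v0 v2].
have [w [wuv E]] := ln_quad_MVT v^-1 8^-1 v u0 v0.
have w0 : 0 < w.
  by case/andP: wuv => + _; apply: lt_le_trans; rewrite lt_min u0 v0.
have w2 : w <= 2.
  by case/andP: wuv => _ /le_trans; apply; rewrite ge_max u2 v2.
have sgn : 0 <= (w - v) * (u - v).
  case/andP: wuv; case: (leP u v) => uv h1 h2; last by rewrite mulr_ge0//; lra.
  by rewrite -mulrNN mulr_ge0//; lra.
suff : (w^-1 - v^-1 + 8^-1 * (2 * (w - v))) * (u - v) <= 0.
  rewrite -E subrr expr0n /= mulr0 addr0.
  have -> : (u - v) / v = v^-1 * u - v^-1 * v by field; rewrite gt_eqF.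
  by lra.
have -> : (w^-1 - v^-1 + 8^-1 * (2 * (w - v))) * (u - v) =
    - (((w * v)^-1 - 4^-1) * ((w - v) * (u - v))).
  by field; rewrite !gt_eqF.
rewrite oppr_le0 mulr_ge0// subr_ge0 lef_pV2 ?posrE ?mulr_gt0//.
by nra.
Qed.

(** The derivative of the remainder is [(w - 1)^2 / w]; the constant [2] bounds [1 / w] for
    [w >= 1/2]. *)
Lemma ln1D_approx s : `|s| <= 2^-1 -> `|ln (1 + s) - s + s ^+ 2 / 2| <= 2 * `|s| ^+ 3.
Proof.
move=> s2; have s2' := s2; move: s2; rewrite ler_norml => /andP[s2 s3].
have u0 : 0 < 1 + s by lra.
have [w [wuv E]] := ln_quad_MVT 1 2^-1 1 u0 ltr01.
have -> : ln (1 + s) - s + s ^+ 2 / 2 = (w^-1 - 1 + 2^-1 * (2 * (w - 1))) * s.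
  rewrite [RHS](_ : _ = (w^-1 - 1 + 2^-1 * (2 * (w - 1))) * (1 + s - 1)).
    by rewrite -E ln1; field.
  by congr (_ * _); ring.
have w2 : 2^-1 <= w.
  case/andP: wuv => + _; apply: le_trans; rewrite le_min; apply/andP; split; lra.
have w0 : 0 < w by lra.
have ws : `|w - 1| <= `|s|.
  case/andP: wuv; case: (leP (1 + s) 1) => h h1 h2.
    by rewrite !ler0_norm; lra.
  by rewrite !ger0_norm; lra.
have -> : w^-1 - 1 + 2^-1 * (2 * (w - 1)) = (w - 1) ^+ 2 / w.
  by field; rewrite gt_eqF.
rewrite normrM (exprSr `|s|) mulrA; apply: ler_wpM2r => //; rewrite normrM normrX.
rewrite mulrC ler_pM// ?exprn_ge0//.
  by rewrite normfV ger0_norm ?(ltW w0)// -[leRHS]invrK lef_pV2 ?posrE//; lra.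
by rewrite ler_pXn2r// nnegrE.
Qed.

(* The truncation matters: [v `^ p] is [1] for [v < 0]. *)
Definition pospow p v : R := (Num.max 0 v) `^ p.

Lemma pospow_ge0 p v : 0 <= pospow p v. Proof. exact: powR_ge0. Qed.

Lemma pospow_le0 p v : p != 0 -> v <= 0 -> pospow p v = 0.
Proof. by move=> p0 v0; rewrite /pospow max_l// powR0. Qed.

Lemma pospow_powR p v : 0 <= v -> pospow p v = v `^ p.
Proof. by move=> v0; rewrite /pospow max_r. Qed.

Lemma pospow_expR p v : 0 < v -> pospow p v = expR (p * ln v).
Proof. by move=> v0; rewrite pospow_powR ?ltW// /powR gt_eqF. Qed.

Lemma pospowM p v w : 0 < v -> pospow p (v * w) = pospow p v * pospow p w.
Proof.
move=> v0; rewrite /pospow (max_r (ltW v0)) -powRM ?le_max ?lexx ?(ltW v0)//.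
by rewrite maxr_pMr ?mulr0// ltW.
Qed.

(** A positive exponent makes the factor vanish at the edge of its support. This is why the weight,
    cut off outside [A], stays continuous on the whole space. *)
Lemma pospow_continuous p : 0 < p -> continuous (pospow p).
Proof.
move=> p0 v; rewrite /continuous_at.
have [v0|v0|->] := ltgtP v 0.
- rewrite (pospow_le0 (lt0r_neq0 p0) (ltW v0)).
  have : cst 0 w @[w --> v] --> (0 : R) by exact: cvg_cst.
  apply: cvg_trans; apply: near_eq_cvg; near=> w.
  rewrite pospow_le0 ?lt0r_neq0//; apply: ltW; near: w.
  exact: lt_nbhsl.
- rewrite pospow_expR//.
  have : expR (p * ln w) @[w --> v] --> expR (p * ln v).
    apply: (@continuous_comp _ _ _ (fun w => p * ln w) expR); last exact: continuous_expR.
    by apply: cvgM; [exact: cvg_cst | exact: continuous_ln].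
  apply: cvg_trans; apply: near_eq_cvg; near=> w.
  by rewrite pospow_expR//; near: w; exact: lt_nbhsr.
- rewrite pospow_le0 ?lt0r_neq0//; apply/cvgrPdist_lt => e e0.
  near=> w; rewrite sub0r normrN ger0_norm ?pospow_ge0//.
  have [w0|w0] := leP w 0; first by rewrite pospow_le0 ?lt0r_neq0.
  rewrite pospow_powR ?ltW//.
  have -> : e = (e `^ (p^-1)) `^ p by rewrite -powRrM mulVf ?lt0r_neq0// powRr1// ltW.
  apply: gt0_ltr_powR => //; rewrite ?nnegrE ?powR_ge0 ?ltW//.
  by near: w; apply: lt_nbhsl; exact: powR_gt0.
Unshelve. all: by end_near. Qed.

(* [v] is the length of the factor at the maximum, so that [v * w] stays in [0, 2]. *)
Lemma pospow_le_expR p v w : 0 < p -> 0 < v <= 2 -> v * w <= 2 ->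
  pospow p w <= expR (p * ((w - 1) - v ^+ 2 * (w - 1) ^+ 2 / 8)).
Proof.
move=> p0 v02 vw2; have /andP[v0 v2] := v02.
have [w0|w0] := leP w 0; first by rewrite pospow_le0 ?lt0r_neq0 ?expR_ge0.
rewrite pospow_expR// ler_expR ler_pM2l//.
have vw : 0 < v * w <= 2 by rewrite mulr_gt0.
have := ln_le_quad vw v02; rewrite lnM ?posrE//.
have -> : (v * w - v) / v = w - 1 by field; rewrite gt_eqF.
have -> : (v * w - v) ^+ 2 = v ^+ 2 * (w - 1) ^+ 2 by ring.
by lra.
Qed.

Lemma cvg_invsqrt (k : nat -> R) : k n @[n --> \oo] --> +oo ->
  (Num.sqrt (k n))^-1 @[n --> \oo] --> 0.
Proof.
move=> /cvgryPgt koo; apply/cvgrPdist_lt => e e0; near=> n.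
have kn : (e^-1) ^+ 2 < k n by near: n; exact: koo.
have e1 : 0 < e^-1 by rewrite invr_gt0.
have ks : e^-1 < Num.sqrt (k n).
  by rewrite -[ltLHS]ger0_norm ?(ltW e1)// -sqrtr_sqr ltr_sqrt// (lt_trans _ kn)// exprn_gt0.
have k0 : 0 < Num.sqrt (k n) by exact: lt_trans ks.
rewrite sub0r normrN ger0_norm ?invr_ge0 ?ltW//.
by rewrite -[ltRHS]invrK ltf_pV2.
Unshelve. all: by end_near. Qed.

(** The exponential removes the first-order term [m t sqrt k], which has no finite limit unless
    [m t = 0]. What remains is [- m t^2 / 2], a cubic remainder multiplied by [k], of order
    [1 / sqrt k], and [d ln (1 + t / sqrt k)], which tends to [0]: bounded shifts of the exponent
    are invisible in the limit. *)
Lemma pospow_cvg (k : nat -> R) m d t : (forall n, 0 < k n) ->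
  k n @[n --> \oo] --> +oo ->
  pospow (k n * m + d) (1 + t / Num.sqrt (k n)) *
    expR (- (k n * m * (t / Num.sqrt (k n)))) @[n --> \oo] --> expR (- (m * t ^+ 2 / 2)).
Proof.
move=> k0 koo; pose e n := (Num.sqrt (k n))^-1.
have e0 n : 0 < e n by rewrite invr_gt0 sqrtr_gt0.
have ke n : k n * e n ^+ 2 = 1.
  by rewrite /e exprVn sqr_sqrtr ?ltW// mulfV// gt_eqF.
have ecvg : e n @[n --> \oo] --> 0 by exact: cvg_invsqrt.
have tecvg : t * e n @[n --> \oo] --> 0.
  by rewrite -(mulr0 t); apply: cvgM => //; exact: cvg_cst.
have te : \forall n \near \oo, `|t * e n| <= 2^-1.
  move/cvgrPdist_le : tecvg => /(_ 2^-1); rewrite invr_gt0 => /(_ (ltr0Sn _ _)).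
  by apply: filterS => n; rewrite sub0r normrN.
pose r n := ln (1 + t * e n) - t * e n + (t * e n) ^+ 2 / 2.
have rcvg : k n * r n @[n --> \oo] --> 0.
  have b0 : 2 * `|t| ^+ 3 * e n @[n --> \oo] --> 0.
    by rewrite -(mulr0 (2 * `|t| ^+ 3)); apply: cvgM => //; exact: cvg_cst.
  apply/cvgrPdist_le => eps eps0; move/cvgrPdist_le : b0 => /(_ eps eps0) b0.
  near=> n; rewrite sub0r normrN normrM (ger0_norm (ltW (k0 n))).
  apply: (@le_trans _ _ (2 * `|t| ^+ 3 * e n)); last first.
    have : `|0 - 2 * `|t| ^+ 3 * e n| <= eps by near: n; exact: b0.
    by rewrite sub0r normrN; apply: le_trans; exact: ler_norm.
  have rn : `|r n| <= 2 * `|t * e n| ^+ 3.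
    by apply: ln1D_approx; near: n; exact: te.
  apply: le_trans (ler_wpM2l (ltW (k0 n)) rn) _.
  rewrite normrM (ger0_norm (ltW (e0 n))).
  rewrite (_ : k n * _ = 2 * `|t| ^+ 3 * e n * (k n * e n ^+ 2)); last by ring.
  by rewrite ke mulr1.
have lcvg : ln (1 + t * e n) @[n --> \oo] --> 0.
  have -> : (0 : R) = ln (1 + 0) by rewrite addr0 ln1.
  apply: (cvg_comp (fun n => 1 + t * e n)).
    by apply: cvgD; [exact: cvg_cst | exact: tecvg].
  by apply: continuous_ln; rewrite addr0.
have main : m * (k n * r n) - m * t ^+ 2 / 2 + d * ln (1 + t * e n) @[n --> \oo]
    --> - (m * t ^+ 2 / 2).
  rewrite [X in _ --> X](_ : _ = m * 0 - m * t ^+ 2 / 2 + d * 0); last by ring.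
  apply: cvgD; last by apply: cvgM => //; exact: cvg_cst.
  by apply: cvgB; [apply: cvgM => //; exact: cvg_cst | exact: cvg_cst].
have : expR (m * (k n * r n) - m * t ^+ 2 / 2 + d * ln (1 + t * e n)) @[n --> \oo]
    --> expR (- (m * t ^+ 2 / 2)).
  by apply: (cvg_comp _ _ main); exact: continuous_expR.
apply: cvg_trans; apply: near_eq_cvg; near=> n.
have te0 : 0 < 1 + t * e n.
  have : `|t * e n| <= 2^-1 by near: n; exact: te.
  by rewrite ler_norml => /andP[h _]; lra.
rewrite -/(e n) pospow_expR// -expRD; congr expR.
transitivity (m * (k n * (ln (1 + t * e n) - t * e n) + (k n * e n ^+ 2) * (t ^+ 2 / 2)) -
  m * t ^+ 2 / 2 + d * ln (1 + t * e n)); first by rewrite /r; field.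
by rewrite ke; ring.
Unshelve. all: by end_near. Qed.

End RealLemmas.

(** * The Jacobi ensemble at large kappa *)

Section LaplaceMethod.
Context {R : realType}.

Lemma sum_pairs N (f : 'I_N -> 'I_N -> R) :
  \sum_(i < N) \sum_(j < N | j != i) f i j =
  \sum_(i < N) \sum_(j < N | (i < j)%N) (f i j + f j i).
Proof.
under [RHS]eq_bigr do rewrite big_split /=.
rewrite big_split /= [X in _ = _ + X](exchange_big_dep xpredT)//= -big_split /=.
apply: eq_bigr => i _; rewrite (bigID (fun j : 'I_N => (i < j)%N)) /=; congr (_ + _).
  by apply: eq_bigl => j; rewrite -val_eqE /=; case: ltngtP.
by apply: eq_bigl => j; rewrite -val_eqE /=; case: ltngtP.
Qed.

Variables (N : nat) (a b : R) (z : 'rV[R]_N).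
Hypothesis a0 : 0 <= a.
Hypothesis b0 : 0 < b.
Hypothesis z_lt : forall i j : 'I_N, (i < j)%N -> z ord0 i < z ord0 j.
Hypothesis z_in : forall i, -1 < z ord0 i < 1.
Hypothesis z_crit : forall i, \sum_(l < N | l != i) (z ord0 i - z ord0 l)^-1 =
  (a + b) / 2 / (1 - z ord0 i) - b / 2 / (1 + z ord0 i).

Let dz_gt0 (i j : 'I_N) : (i < j)%N -> 0 < z ord0 j - z ord0 i.
Proof. by move=> /z_lt; rewrite subr_gt0. Qed.

Let zl_gt0 i : 0 < 1 - z ord0 i.
Proof. by have := z_in i; lra. Qed.

Let zr_gt0 i : 0 < 1 + z ord0 i.
Proof. by have := z_in i; lra. Qed.

(** Relative increments of the factors of the weight: when [z] moves to [z + y], the factors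
    [z_j - z_i], [1 - z_i] and [1 + z_i] are multiplied by [1 + gap], [1 + gapl] and [1 + gapr]. *)
Let gap (y : 'rV[R]_N) i j := (y ord0 j - y ord0 i) / (z ord0 j - z ord0 i).
Let gapl (y : 'rV[R]_N) i := - y ord0 i / (1 - z ord0 i).
Let gapr (y : 'rV[R]_N) i := y ord0 i / (1 + z ord0 i).

(** The left side is the derivative of [W] at [z] in the direction [y]. Once pairs are regrouped by
    index, the coefficient of [y_i] is the difference of the two sides of [z_crit]. *)
Lemma critical_point (y : 'rV[R]_N) :
  \sum_(i < N) \sum_(j < N | (i < j)%N) gap y i j
  + \sum_(i < N) ((a + b) / 2 * gapl y i + b / 2 * gapr y i) = 0.
Proof.
have -> : \sum_(i < N) \sum_(j < N | (i < j)%N) gap y i j =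
    \sum_(i < N) \sum_(j < N | j != i) y ord0 i / (z ord0 i - z ord0 j).
  rewrite sum_pairs; apply: eq_bigr => i _; apply: eq_bigr => j /dz_gt0 ij.
  rewrite /gap; field; rewrite gt_eqF//=.
  by rewrite -opprB oppr_eq0 gt_eqF.
rewrite -big_split big1//= => i _; rewrite -mulr_sumr z_crit /gapl /gapr.
by field; rewrite !gt_eqF.
Qed.

(** As a weighted sum of squares of relative increments, the form is visibly nonnegative and can be
    matched term by term with the limits of the single factors. *)
Lemma qform_S_mat (y : 'rV[R]_N) : qform (S_mat a b z) y =
  \sum_(i < N) \sum_(j < N | (i < j)%N) gap y i j ^+ 2
  + \sum_(i < N) ((a + b) / 2 * gapl y i ^+ 2 + b / 2 * gapr y i ^+ 2).
Proof.
rewrite qformE.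
pose c (i j : 'I_N) := ((z ord0 i - z ord0 j) ^+ 2)^-1.
pose f (i j : 'I_N) := c i j * (y ord0 i ^+ 2 - y ord0 i * y ord0 j).
have -> : \sum_(i < N) \sum_(j < N | (i < j)%N) gap y i j ^+ 2 =
    \sum_(i < N) \sum_(j < N | j != i) f i j.
  rewrite sum_pairs; apply: eq_bigr => i _; apply: eq_bigr => j /dz_gt0 ij.
  rewrite /gap /f /c; field; rewrite gt_eqF//=.
  by rewrite -opprB oppr_eq0 gt_eqF.
rewrite -big_split; apply: eq_bigr => j _ /=.
rewrite (bigD1 j)//= mxE eqxx mulrDl mulr_suml.
rewrite [X in _ + X](_ : _ = - \sum_(i < N | i != j) c j i * (y ord0 i * y ord0 j)); last first.
  rewrite -sumrN; apply: eq_bigr => i ij; rewrite mxE (negbTE ij) /c.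
  by rewrite -[z ord0 i - _]opprB sqrrN; ring.
rewrite [X in _ = X + _](_ : _ = y ord0 j ^+ 2 * (\sum_(i < N | i != j) c j i)
    - \sum_(i < N | i != j) c j i * (y ord0 i * y ord0 j)); last first.
  by rewrite mulr_sumr -sumrB; apply: eq_bigr => i _; rewrite /f; ring.
rewrite /gapl /gapr -/(c j); field.
by rewrite !gt_eqF.
Qed.

Let e1 kappa := kappa * (a + b) / 2 - 2^-1.
Let e2 kappa := kappa * b / 2 - 2^-1.

Lemma in_AP (x : 'rV[R]_N) : in_A x ->
  (forall i, -1 <= x ord0 i <= 1) /\
  (forall i j : 'I_N, (i <= j)%N -> x ord0 i <= x ord0 j).
Proof.
move=> /andP[/forallP h1 /forallP h2]; split=> [i|i j ij]; first exact: h1.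
by have /forallP/(_ j)/implyP := h2 i; apply.
Qed.

(** The indicator of [A] is absorbed by the truncated powers: each violated inequality makes some
    factor vanish, all exponents being positive. *)
Lemma jacobi_weightE kappa (x : 'rV[R]_N) : 0 < kappa -> 0 < e2 kappa ->
  jacobi_weight a b kappa x =
  (\prod_(i < N) \prod_(j < N | (i < j)%N) pospow kappa (x ord0 j - x ord0 i)) *
  \prod_(i < N) (pospow (e1 kappa) (1 - x ord0 i) * pospow (e2 kappa) (1 + x ord0 i)).
Proof.
move=> k0 e20.
have e10 : 0 < e1 kappa.
  by apply: lt_le_trans e20 _; rewrite /e1 /e2; have := mulr_ge0 (ltW k0) a0; lra.
rewrite /jacobi_weight; case: ifP => [/in_AP[x1 x2]|].
  congr (_ * _).
    apply: eq_bigr => i _; apply: eq_bigr => j ij.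
    by rewrite pospow_powR// subr_ge0 x2// ltnW.
  apply: eq_bigr => i _; have := x1 i => xi.
  by rewrite !pospow_powR//; lra.
move=> /negbT; rewrite negb_and => /orP[/forallPn[i]|/forallPn[i /forallPn[j]]].
  rewrite negb_and -!ltNge => /orP xi; apply/esym/eqP; rewrite mulf_eq0; apply/orP; right.
  apply/prodf_eq0; exists i => //; rewrite mulf_eq0.
  by case: xi => xi; apply/orP; [right|left]; rewrite pospow_le0 ?lt0r_neq0//; lra.
rewrite negb_imply -ltNge => /andP[ij xij].
have {}ij : (i < j)%N.
  by move: ij; rewrite leq_eqVlt => /orP[/eqP/val_inj ijE|//]; rewrite ijE ltxx in xij.
apply/esym/eqP; rewrite mulf_eq0; apply/orP; left.
apply/prodf_eq0; exists i => //; apply/prodf_eq0; exists j => //.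
by rewrite pospow_le0 ?lt0r_neq0//; lra.
Qed.

Let scaled kappa (y : 'rV[R]_N) :=
  (\prod_(i < N) \prod_(j < N | (i < j)%N) pospow kappa (1 + gap y i j / Num.sqrt kappa)) *
  \prod_(i < N) (pospow (e1 kappa) (1 + gapl y i / Num.sqrt kappa) *
                 pospow (e2 kappa) (1 + gapr y i / Num.sqrt kappa)).

Lemma jacobi_weight_scaled kappa (y : 'rV[R]_N) : 0 < kappa -> 0 < e2 kappa ->
  jacobi_weight a b kappa (z + (Num.sqrt kappa)^-1 *: y) =
  jacobi_weight a b kappa z * scaled kappa y.
Proof.
move=> k0 e20; rewrite !jacobi_weightE// /scaled mulrACA.
have s0 : Num.sqrt kappa != 0 by rewrite gt_eqF// sqrtr_gt0.
congr (_ * _); rewrite -big_split /=.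
  apply: eq_bigr => i _; rewrite -big_split; apply: eq_bigr => j ij /=.
  rewrite -pospowM ?dz_gt0// /gap !mxE; congr pospow.
  by field; rewrite s0 gt_eqF// dz_gt0.
apply: eq_bigr => i _; rewrite mulrACA -!pospowM// /gapl /gapr !mxE.
by congr (pospow _ _ * pospow _ _); field; rewrite s0 gt_eqF.
Qed.

Lemma jacobi_weight_zeros_gt0 kappa : 0 < kappa -> 0 < e2 kappa ->
  0 < jacobi_weight a b kappa z.
Proof.
move=> k0 e20; rewrite jacobi_weightE// mulr_gt0//.
  apply: prodr_gt0 => i _; apply: prodr_gt0 => j ij.
  by rewrite pospow_expR ?expR_gt0 ?dz_gt0.
by apply: prodr_gt0 => i _; rewrite !pospow_expR// mulr_gt0 ?expR_gt0.
Qed.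

Lemma scaled_ge0 kappa y : 0 <= scaled kappa y.
Proof.
rewrite mulr_ge0// prodr_ge0// => i _; first by rewrite prodr_ge0// => j _; exact: pospow_ge0.
by rewrite mulr_ge0// pospow_ge0.
Qed.

Lemma scaled_continuous kappa : 0 < kappa -> 0 < e2 kappa -> continuous (scaled kappa).
Proof.
move=> k0 e20 y.
have e10 : 0 < e1 kappa.
  by apply: lt_le_trans e20 _; rewrite /e1 /e2; have := mulr_ge0 (ltW k0) a0; lra.
have ppc p (c : R) (h : 'rV[R]_N -> R) : 0 < p -> continuous h ->
    pospow p (1 + h w / c) @[w --> y] --> pospow p (1 + h y / c).
  move=> p0 hc; apply: (@continuous_comp _ _ _ (fun w => 1 + h w / c) (pospow p)).
    apply: continuousD; first exact: cst_continuous.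
    by apply: continuousM; [exact: hc | exact: cst_continuous].
  exact: pospow_continuous.
have cc (i : 'I_N) : continuous (fun w : 'rV[R]_N => w ord0 i) by exact: coord_continuous.
have gapc i j : continuous (fun w => gap w i j).
  apply: continuous_mulr => w; last exact: cst_continuous.
  by apply: continuousB; exact: cc.
have gaplc i : continuous (fun w => gapl w i).
  apply: continuous_mulr => w; last exact: cst_continuous.
  by apply: continuousN; exact: cc.
have gaprc i : continuous (fun w => gapr w i).
  by apply: continuous_mulr => w; [exact: cc | exact: cst_continuous].
rewrite /continuous_at /scaled; apply: (@cvgM _ _ (nbhs y)).
  apply: (cvgr_prod (F := nbhs y)) => i _; apply: (cvgr_prod (F := nbhs y)) => j _.
  exact: (ppc _ _ (fun w => gap w i j)).
apply: (cvgr_prod (F := nbhs y)) => i _; apply: (@cvgM _ _ (nbhs y)).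
  exact: (ppc _ _ (fun w => gapl w i)).
exact: (ppc _ _ (fun w => gapr w i)).
Qed.

Lemma scaled_cvg (k : nat -> R) (y : 'rV[R]_N) : (forall n, 0 < k n) ->
  k n @[n --> \oo] --> +oo ->
  scaled (k n) y @[n --> \oo] --> expR (- qform (S_mat a b z) y / 2).
Proof.
move=> k0 koo.
pose s n := Num.sqrt (k n).
(* The inserted exponentials multiply to [1] because [z] is critical. *)
have balanced n : scaled (k n) y =
  (\prod_(i < N) \prod_(j < N | (i < j)%N)
     (pospow (k n * 1 + 0) (1 + gap y i j / s n) * expR (- (k n * 1 * (gap y i j / s n))))) *
  \prod_(i < N)
    ((pospow (k n * ((a + b) / 2) + - 2^-1) (1 + gapl y i / s n) *
       expR (- (k n * ((a + b) / 2) * (gapl y i / s n)))) *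
     (pospow (k n * (b / 2) + - 2^-1) (1 + gapr y i / s n) *
       expR (- (k n * (b / 2) * (gapr y i / s n))))).
  under [X in _ = X * _]eq_bigr do rewrite big_split /= -expR_sum.
  under [X in _ = _ * X]eq_bigr do rewrite mulrACA -expRD.
  rewrite !big_split /= -!expR_sum mulrACA -expRD.
  rewrite [X in _ = _ * expR X](_ : _ = 0) ?expR0 ?mulr1; last first.
    transitivity (- (k n / s n) * 0); last by rewrite mulr0.
    rewrite -[X in _ = _ * X](critical_point y) mulrDr !mulr_sumr; congr (_ + _).
      by apply: eq_bigr => i _; rewrite mulr_sumr; apply: eq_bigr => j _; ring.
    by apply: eq_bigr => i _; ring.
  rewrite /scaled addr0 -/(s n); congr (_ * _); rewrite -big_split /=.
  by apply: eq_bigr => i _; rewrite /e1 /e2 !mulrA.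
under eq_fun do rewrite balanced.
have -> : - qform (S_mat a b z) y / 2 =
    \sum_(i < N) \sum_(j < N | (i < j)%N) - (1 * gap y i j ^+ 2 / 2) +
    \sum_(i < N) (- ((a + b) / 2 * gapl y i ^+ 2 / 2) + - (b / 2 * gapr y i ^+ 2 / 2)).
  rewrite qform_S_mat opprD mulrDl -!sumrN !mulr_suml; congr (_ + _).
    by apply: eq_bigr => i _; rewrite mulNr mulr_suml -sumrN; apply: eq_bigr => j _; ring.
  by apply: eq_bigr => i _; ring.
rewrite expRD !expR_sum; apply: cvgM.
  apply: cvgr_prod => i _; rewrite expR_sum; apply: cvgr_prod => j _.
  exact: pospow_cvg.
by apply: cvgr_prod => i _; rewrite expRD; apply: cvgM; exact: pospow_cvg.
Qed.

(** The price of the exponents [- 1/2]: they leave the linear term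
    [(h_i / (1 - z_i) - h_i / (1 + z_i)) / 2], and the displacement satisfies [|h_i| <= 2] on
    [A]. *)
Let C1 := \sum_(i < N) ((1 - z ord0 i)^-1 + (1 + z ord0 i)^-1).

(** The quadratic decay comes from the boundary factors alone. They give [(e1 + e2) h_i^2 / 8], and
    [kappa b >= 2] yields [e1 + e2 >= kappa b / 2]; since [y_i^2 = kappa h_i^2], the constant is
    [b / 16], free of [kappa]. *)
Lemma scaled_dominated kappa : 2 <= kappa * b -> 0 < kappa ->
  gdominated (fun x => expR (- (b / 16 * x ^+ 2))) (expR C1) (scaled kappa).
Proof.
move=> kb k0 y; have e20 : 0 < e2 kappa by rewrite /e2; lra.
have ka : 0 <= kappa * a by rewrite mulr_ge0// ltW.
have e10 : 0 < e1 kappa by rewrite /e1; lra.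
rewrite ger0_norm ?scaled_ge0// -expR_sqnorm -expRD.
set s := Num.sqrt kappa; have s0 : 0 < s by rewrite sqrtr_gt0.
pose h := s^-1 *: y; pose x := z + h.
have [xA|xA] := boolP (in_A x); last first.
  (* Outside [A] the rescaled density is zero, because the weight at [z] is not. *)
  have := jacobi_weight_scaled y k0 e20; rewrite {1}/jacobi_weight -/s -/h -/x (negbTE xA).
  move/esym/eqP; rewrite mulf_eq0 gt_eqF ?jacobi_weight_zeros_gt0//= => /eqP ->.
  exact: expR_ge0.
have [x1 x2] := in_AP xA.
have w1 (t : R) : 1 + t - 1 = t by ring.
have xE i : x ord0 i = z ord0 i + h ord0 i by rewrite mxE.
have gapE i j : gap y i j / s = gap h i j by rewrite /gap !mxE; ring.
have gaplE i : gapl y i / s = gapl h i by rewrite /gapl !mxE; ring.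
have gaprE i : gapr y i / s = gapr h i by rewrite /gapr !mxE; ring.
pose T i := e1 kappa * (gapl h i - h ord0 i ^+ 2 / 8) + e2 kappa * (gapr h i - h ord0 i ^+ 2 / 8).
apply: (@le_trans _ _ (expR (\sum_(i < N) \sum_(j < N | (i < j)%N) kappa * gap h i j +
    \sum_(i < N) T i))).
  rewrite expRD !expR_sum; apply: ler_pM.
  - by apply: prodr_ge0 => i _; apply: prodr_ge0 => j _; exact: pospow_ge0.
  - by apply: prodr_ge0 => i _; rewrite mulr_ge0// pospow_ge0.
  - apply: ler_prod => i _; apply/andP; split.
      by apply: prodr_ge0 => j _; exact: pospow_ge0.
    rewrite expR_sum; apply: ler_prod => j ij; rewrite pospow_ge0 /= gapE.
    apply: le_trans (@pospow_le_expR _ _ (z ord0 j - z ord0 i) _ k0 _ _) _.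
    + by rewrite dz_gt0//=; have := z_in i; have := z_in j; lra.
    + have -> : (z ord0 j - z ord0 i) * (1 + gap h i j) = x ord0 j - x ord0 i.
        by rewrite !xE /gap; field; rewrite gt_eqF// dz_gt0.
      by have := x1 i; have := x1 j; lra.
    (* The quadratic gain of the repulsion factors is discarded; only their first-order term is
       needed, for the cancellation at [z]. *)
    + rewrite ler_expR ler_pM2l// !w1 gerBl.
      by rewrite mulr_ge0// mulr_ge0// sqr_ge0.
  - apply: ler_prod => i _; rewrite mulr_ge0 ?pospow_ge0//= gaplE gaprE expRD.
    have := x1 i; rewrite xE => x1i; have zi := z_in i.
    apply: ler_pM; rewrite ?pospow_ge0//.
      apply: le_trans (@pospow_le_expR _ _ (1 - z ord0 i) _ e10 _ _) _.
      + by rewrite zl_gt0/=; lra.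
      + have -> : (1 - z ord0 i) * (1 + gapl h i) = 1 - z ord0 i - h ord0 i.
          by rewrite /gapl; field; rewrite gt_eqF.
        by lra.
      + rewrite ler_expR ler_pM2l// !w1 lerD2l lerN2.
        by rewrite le_eqVlt; apply/orP; left; apply/eqP; rewrite /gapl; field; rewrite gt_eqF.
    apply: le_trans (@pospow_le_expR _ _ (1 + z ord0 i) _ e20 _ _) _.
    + by rewrite zr_gt0/=; lra.
    + have -> : (1 + z ord0 i) * (1 + gapr h i) = 1 + z ord0 i + h ord0 i.
        by rewrite /gapr; field; rewrite gt_eqF.
      by lra.
    + rewrite ler_expR ler_pM2l// !w1 lerD2l lerN2.
      by rewrite le_eqVlt; apply/orP; left; apply/eqP; rewrite /gapr; field; rewrite gt_eqF.
rewrite ler_expR.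
pose D i := 2^-1 * (h ord0 i / (1 - z ord0 i) - h ord0 i / (1 + z ord0 i)) -
  (e1 kappa + e2 kappa) * h ord0 i ^+ 2 / 8.
have -> : \sum_(i < N) \sum_(j < N | (i < j)%N) kappa * gap h i j + \sum_(i < N) T i =
    \sum_(i < N) D i.
  transitivity (kappa * 0 + \sum_(i < N) D i); last by rewrite mulr0 add0r.
  rewrite -[X in _ = _ * X + _](critical_point h) mulrDr -addrA !mulr_sumr; congr (_ + _).
    by apply: eq_bigr => i _; rewrite mulr_sumr.
  rewrite -big_split /=; apply: eq_bigr => i _; rewrite /T /D /e1 /e2 /gapl /gapr.
  by field; rewrite !gt_eqF.
rewrite /C1 /sqnorm mulr_sumr -sumrN -big_split /=; apply: ler_sum => i _.
have := x1 i; rewrite xE => x1i; have zi := z_in i; rewrite /D.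
have hl : h ord0 i / (1 - z ord0 i) <= 2 / (1 - z ord0 i).
  by rewrite ler_pM2r ?invr_gt0//; lra.
have hr : - h ord0 i / (1 + z ord0 i) <= 2 / (1 + z ord0 i).
  by rewrite ler_pM2r ?invr_gt0//; lra.
have yh : y ord0 i ^+ 2 = kappa * h ord0 i ^+ 2.
  by rewrite !mxE exprMn exprVn sqr_sqrtr ?(ltW k0)// mulrA mulfV ?mul1r// gt_eqF.
have h2 : kappa * b / 2 * h ord0 i ^+ 2 <= (e1 kappa + e2 kappa) * h ord0 i ^+ 2.
  by rewrite ler_wpM2r ?sqr_ge0// /e1 /e2; lra.
rewrite yh; move: hl hr h2; rewrite mulNr.
move: (h ord0 i / (1 - z ord0 i)) (h ord0 i / (1 + z ord0 i)) ((1 - z ord0 i)^-1)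
  ((1 + z ord0 i)^-1) (h ord0 i ^+ 2) => p q u v w hl hr h2.
by lra.
Qed.


Lemma S_mat_sym : (S_mat a b z)^T = S_mat a b z.
Proof.
apply/matrixP => i j; rewrite !mxE eq_sym; have [->//|ij] := eqVneq i j.
by rewrite -(opprB (z ord0 i)) sqrrN.
Qed.

(** Only the terms in [1 + z_i] are kept, and [1 + z_i < 2]. Half of [b / 8] is the constant of
    [scaled_dominated], so one Gaussian majorizes both the densities and their limit. *)
Lemma S_mat_posdef (y : 'rV[R]_N) : b / 8 * sqnorm y <= qform (S_mat a b z) y.
Proof.
rewrite qform_S_mat /sqnorm mulr_sumr -[leLHS]add0r; apply: lerD.
  by apply: sumr_ge0 => i _; apply: sumr_ge0 => j _; exact: sqr_ge0.
apply: ler_sum => i _; rewrite -[leLHS]add0r; apply: lerD.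
  by rewrite mulr_ge0 ?sqr_ge0// divr_ge0// addr_ge0// ltW.
rewrite /gapr exprMn exprVn [leRHS]mulrA ler_pdivlMr; last by rewrite exprn_gt0.
have -> : b / 8 * y ord0 i ^+ 2 * (1 + z ord0 i) ^+ 2 =
    b / 2 * y ord0 i ^+ 2 * ((1 + z ord0 i) ^+ 2 / 4) by field.
rewrite ler_piMr//; first by rewrite mulr_ge0 ?sqr_ge0// divr_ge0// ltW.
by have := z_in i; have := zr_gt0 i; nra.
Qed.

(** The substitution [y = sqrt kappa (x - z)]. The prefactor does not depend on [f], hence cancels
    between the numerator of the expectation and its normalizing constant. *)
Lemma int_RN_jacobi_weight kappa (f : 'rV[R]_N -> R) M : 2 <= kappa * b -> 0 < kappa ->
  continuous f -> (forall y, `|f y| <= M) ->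
  int_RN (fun x => f (Num.sqrt kappa *: (x - z)) * jacobi_weight a b kappa x) =
  ((Num.sqrt kappa ^- N * jacobi_weight a b kappa z)%:E *
    int_RN (fun y => (f y * scaled kappa y)%R))%E.
Proof.
move=> kb k0 fc fM; have e20 : 0 < e2 kappa by rewrite /e2; lra.
have M0 : 0 <= M by apply: le_trans (fM 0).
set s := Num.sqrt kappa; have s0 : 0 < s by rewrite sqrtr_gt0.
have b16 : 0 < b / 16 by rewrite divr_gt0.
have gi := integrable_gaussian b16.
have g01 x := gaussian_itv x b16.
pose G y := f y * scaled kappa y.
pose w := jacobi_weight a b kappa z.
have w0 : 0 < w by exact: jacobi_weight_zeros_gt0.
have Gc : continuous G by apply: continuous_mulr => //; exact: scaled_continuous.
have Gd : gdominated (fun x => expR (- (b / 16 * x ^+ 2))) (M * expR C1) G.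
  move=> y; rewrite normrM -mulrA; apply: ler_pM => //.
  exact: scaled_dominated.
have MC0 : 0 <= M * expR C1 by rewrite mulr_ge0// expR_ge0.
transitivity (int_RN (fun x => w * G (- (s *: z) + s *: x))).
  apply: eq_int_RN => x; rewrite (addrC (- (s *: z))) -scalerBr /G mulrCA; congr (_ * _).
  rewrite -jacobi_weight_scaled//; congr jacobi_weight.
  by rewrite scalerA mulVf ?gt_eqF// scale1r addrC subrK.
rewrite EFinM -muleA -(int_RNZ g01 gi w MC0 Gc Gd).
apply: (int_RN_affine (G := fun y => w * G y) g01 gi (- (s *: z)) s0
  (mulr_ge0 (ltW w0) MC0)).
  by apply: continuous_mulr => // y; exact: cst_continuous.
by move=> y; rewrite normrM (gtr0_norm w0) -mulrA ler_pM2l.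
Qed.

Lemma jacobi_ensemble_clt : exists Sigma : 'M[R]_N,
  Sigma \in unitmx /\ invmx Sigma = S_mat a b z /\
  forall f : 'rV[R]_N -> R,
    continuous f -> (exists M : R, forall y, `|f y| <= M) ->
    jacobi_expect a b kappa (fun x => f (Num.sqrt kappa *: (x - z)))
      @[kappa --> +oo] --> normal_expect Sigma f.
Proof.
set S := S_mat a b z.
have b8 : 0 < b / 8 by rewrite divr_gt0.
have [S0 IS] := int_RN_gaussian b8 S_mat_sym S_mat_posdef.
have Su : S \in unitmx by rewrite unitmxE unitfE gt_eqF.
exists (invmx S); rewrite unitmx_inv invmxK; split=> //; split=> // f fc [M fM].
have M0 : 0 <= M by apply: le_trans (fM 0).
(* From [K] on, [kappa * b >= 2], so that the exponents are positive and the domination holds. *)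
pose K := 2 / b; have K0 : 0 < K by rewrite divr_gt0.
pose I h kappa := fine (int_RN (fun y => h y * scaled kappa y)).
pose L h := fine (int_RN (fun y => h y * expR (- qform S y / 2))).
have b16 : 0 < b / 16 by rewrite divr_gt0.
have gi := integrable_gaussian b16.
have g01 x := gaussian_itv x b16.
have Sd : gdominated (fun x => expR (- (b / 16 * x ^+ 2))) (expR C1)
    (fun y => expR (- qform S y / 2)).
  have -> : b / 16 = b / 8 / 2 by field.
  move=> y; apply: le_trans (gdominated_expR_qform S_mat_posdef y) _.
  rewrite ler_wpM2r//; first by apply: prodr_ge0 => i _; exact: expR_ge0.
  rewrite -expR0 ler_expR; apply: sumr_ge0 => i _.
  by rewrite addr_ge0// invr_ge0 ltW.
have condK kappa : K <= kappa -> 2 <= kappa * b /\ 0 < kappa.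
  move=> Kk; split; last exact: lt_le_trans Kk.
  by rewrite -ler_pdivrMr.
(* Dominated convergence concerns sequences and asks for the bound at every index. Replacing [kappa]
   by its maximum with [K] provides this, and changes nothing near infinity. *)
have Icvg (h : 'rV[R]_N -> R) (B : R) : continuous h -> (forall y, `|h y| <= B) ->
    I h (Num.max K kappa) @[kappa --> +oo] --> L h.
  move=> hc hB; have B0 : 0 <= B by apply: le_trans (hB 0).
  apply/cvg_pinftyP => u uoo.
  have koo : Num.max K (u n) @[n --> \oo] --> +oo.
    apply/cvgryPge => A; move/cvgryPge : uoo => /(_ A).
    by apply: filterS => n An; rewrite le_max An orbT.
  have kK n : K <= Num.max K (u n) by rewrite le_max lexx.
  apply: (int_RN_cvg g01 gi (C := B * expR C1)).
  - by rewrite mulr_ge0// expR_ge0.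
  - move=> n; have [kb k0] := condK _ (kK n).
    apply: continuous_mulr => //; apply: scaled_continuous => //.
    by rewrite /e2; lra.
  - by apply: continuous_mulr => //; exact: continuous_expR_qform.
  - move=> n y; have [kb k0] := condK _ (kK n).
    rewrite normrM -mulrA; apply: ler_pM => //; exact: scaled_dominated.
  - by move=> y; rewrite normrM -mulrA; apply: ler_pM => //; exact: Sd.
  - move=> y; apply: cvgM; first exact: cvg_cst.
    by apply: scaled_cvg => // n; have [] := condK _ (kK n).
(* The normalizing constant is the numerator for the test function [1], so a single limit statement
   covers both. *)
pose one : 'rV[R]_N -> R := fun=> 1.
have one1 y : `|one y| <= 1 by rewrite normr1.
have onec : continuous one by move=> y; exact: cst_continuous.
have expectE kappa : K <= kappa ->
    jacobi_expect a b kappa (fun x => f (Num.sqrt kappa *: (x - z))) =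
    I f kappa / I one kappa.
  move=> /condK[kb k0]; rewrite /jacobi_expect.
  rewrite (int_RN_jacobi_weight kb k0 fc fM).
  have := int_RN_jacobi_weight kb k0 onec one1.
  rewrite (eq_int_RN (G := jacobi_weight a b kappa)); last by move=> x; rewrite mul1r.
  move=> ->; set c := _ * jacobi_weight _ _ _ _.
  have e20 : 0 < e2 kappa by rewrite /e2; lra.
  have c0 : c != 0.
    rewrite mulf_neq0//; last by rewrite gt_eqF// jacobi_weight_zeros_gt0.
    by rewrite invr_eq0 expf_neq0// gt_eqF// sqrtr_gt0.
  have fin (h : 'rV[R]_N -> R) (B : R) : continuous h -> (forall y, `|h y| <= B) ->
      int_RN (fun y => h y * scaled kappa y) \is a fin_num.
    move=> hc hB; have B0 : 0 <= B by apply: le_trans (hB 0).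
    apply: (int_RN_fin_num g01 gi (C := B * expR C1)).
    - by rewrite mulr_ge0// expR_ge0.
    - by apply: continuous_mulr => //; exact: scaled_continuous.
    - by move=> y; rewrite normrM -mulrA; apply: ler_pM => //; exact: scaled_dominated.
  rewrite !fineM ?(fin _ _ fc fM) ?(fin _ _ onec one1)//= -/(I f kappa) -/(I one kappa).
  by rewrite invfM mulrACA mulfV// mul1r.
pose Z := Num.sqrt ((2 * pi) ^+ N / \det S).
have Z0 : 0 < Z by rewrite sqrtr_gt0 divr_gt0// exprn_gt0// mulr_gt0// pi_gt0.
have L1 : L one = Z.
  rewrite /L (eq_int_RN (G := fun y => expR (- qform S y / 2))); last by move=> y; rewrite mul1r.
  by rewrite IS.
(* As the determinant of [invmx S] is the inverse of that of [S], the normalization of the normal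
   density is exactly [Z = L one]. *)
have -> : normal_expect (invmx S) f = L f / L one.
  rewrite L1 /normal_expect (eq_int_RN (G := fun y => Z^-1 * (f y * expR (- qform S y / 2)))).
    rewrite (int_RNZ g01 gi _ (C := M * expR C1)); first last.
    - by move=> y; rewrite normrM -mulrA; apply: ler_pM => //; exact: Sd.
    - by apply: continuous_mulr => //; exact: continuous_expR_qform.
    - by rewrite mulr_ge0// expR_ge0.
    rewrite fineM//= 1?mulrC//.
    apply: (int_RN_fin_num g01 gi (C := M * expR C1)).
    - by rewrite mulr_ge0// expR_ge0.
    - by apply: continuous_mulr => //; exact: continuous_expR_qform.
    - by move=> y; rewrite normrM -mulrA; apply: ler_pM => //; exact: Sd.
  by move=> y; rewrite /normal_density det_inv invmxK mulrCA.
have : I f (Num.max K kappa) / I one (Num.max K kappa) @[kappa --> +oo]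
    --> L f / L one.
  apply: cvgM; first exact: Icvg fM.
  by apply: cvgV; [rewrite L1 gt_eqF | exact: Icvg one1].
apply: cvg_trans; apply: near_eq_cvg; near=> kappa.
have Kk : K <= kappa by near: kappa; apply: nbhs_pinfty_ge; exact: num_real.
have -> : Num.max K kappa = kappa by exact: max_r.
by rewrite (expectE kappa Kk).
Unshelve. all: by end_near. Qed.

End LaplaceMethod.

Theorem theorem2p6 (R : realType) (N : nat) (a b : R) (z : 'rV[R]_N) :
  0 <= a -> 0 < b ->
  (* z = ordered zeros z_1 < ... < z_N of P_N^{(a+b-1, b-1)} *)
  (forall i j : 'I_N, (i < j)%N -> z ord0 i < z ord0 j) ->
  (forall i : 'I_N, root (jacobi N (a + b - 1) (b - 1)) (z ord0 i)) ->
  exists Sigma : 'M[R]_N,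
    Sigma \in unitmx /\ invmx Sigma = S_mat a b z /\
    (* sqrt(kappa) (X_kappa - z) converges in distribution to N(0, Sigma) *)
    forall f : 'rV[R]_N -> R,
      continuous f -> (exists M : R, forall y, `|f y| <= M) ->
      jacobi_expect a b kappa (fun x => f (Num.sqrt kappa *: (x - z)))
        @[kappa --> +oo] --> normal_expect Sigma f.
Proof.
move=> a0 b0 z_lt rz.
have al1 : -1 < a + b - 1 by lra.
have be1 : -1 < b - 1 by lra.
have zI : injective (fun i => z ord0 i).
  by move=> i j zij; apply: val_inj; case: (ltngtP i j) => // /z_lt; rewrite zij ltxx.
apply: (jacobi_ensemble_clt a0 b0 z_lt) => i; first exact: jacobi_root_itv (rz i).
by rewrite (jacobi_zeros_stieltjes _ al1 be1 zI rz) !subrK.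
Qed.
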